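(* Strong bi-interpretability with parameters is transitive: if $\mathbb{A}$ and $\mathbb{B}$ are strongly bi-interpretable, and $\mathbb{B}$ and $\mathbb{C}$ are strongly bi-interpretable, then $\mathbb{A}$ and $\mathbb{C}$ are strongly bi-interpretable. Moreover, strong injective bi-interpretability, strong absolute bi-interpretability, strong absolute injective bi-interpretability, and syntactic isomorphism are transitive as well.
   Context: **Structures and codes.** $\mathbb{A}=\langle A;L(\mathbb{A})\rangle$ denotes a first-order structure with non-empty underlying set $A$ in the language $L(\mathbb{A})$ (logic with equality; constant, function and predicate symbols); similarly for other letters. Maps are applied to tuples coordinatewise. An interpretation code $\Gamma\colon L(\mathbb{A})\to L(\mathbb{B})$ is a family of $L(\mathbb{B})$-formulas $U_\Gamma(\bar x,\bar y)$, $E_\Gamma(\bar x,\bar x',\bar y)$, $c_\Gamma(\bar x,\bar y)$, $f_\Gamma(\bar x_0,\bar x_1,\ldots,\bar x_{n_f},\bar y)$, $R_\Gamma(\bar x_1,\ldots,\bar x_{n_R},\bar y)$, one for each constant symbol $c$, function symbol $f$, predicate symbol $R$ of $L(\mathbb{A})$, where all tuples $\bar x,\bar x',\bar x_i$ have the same length $\dim\Gamma$ and $|\bar y|=\dim_{\mathrm{par}}\Gamma$. The code is injective if $E_\Gamma$ is the formula $\bar x=\bar x'$, and absolute if $\dim_{\mathrm{par}}\Gamma=0$. For a tuple $\bar p$ from $B$ with $|\bar p|=\dim_{\mathrm{par}}\Gamma$ put $U_\Gamma(\mathbb{B},\bar p)=\{\bar b\mid\mathbb{B}\models U_\Gamma(\bar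 b,\bar p)\}$. The $L(\mathbb{A})$-structure $\Gamma(\mathbb{B},\bar p)$ is well-defined if $U_\Gamma(\mathbb{B},\bar p)\neq\emptyset$ and, on $U_\Gamma(\mathbb{B},\bar p)$, $E_\Gamma(\cdot,\cdot,\bar p)$ defines an equivalence relation $\sim_\Gamma$, each $c_\Gamma$ defines exactly one $\sim_\Gamma$-class, each $f_\Gamma$ defines (the preimage of) the graph $x_0=f(x_1,\ldots,x_{n_f})$ of an operation on $U_\Gamma(\mathbb{B},\bar p)/{\sim_\Gamma}$, and each $R_\Gamma$ defines (the preimage of) a relation on $U_\Gamma(\mathbb{B},\bar p)/{\sim_\Gamma}$; then $\Gamma(\mathbb{B},\bar p)$ is the resulting structure on $U_\Gamma(\mathbb{B},\bar p)/{\sim_\Gamma}$ (when $\sim_\Gamma$ is equality, $U/{\sim_\Gamma}$ is identified with $U$). An interpretation $(\Gamma,\bar p,\mu_\Gamma)\colon\mathbb{A}\rightsquigarrow\mathbb{B}$ consists of a code $\Gamma$, a tuple $\bar p$ such that $\Gamma(\mathbb{B},\bar p)$ is well-defined, and a surjection (coordinate map) $\mu_\Gamma\colon U_\Gamma(\mathbb{B},\bar p)\to A$ that induces an $L(\mathbb{A})$-isomorphism $\bar\mu_\Gamma\colon\Gamma(\mathbb{B},\bar p)\to\mathbb{A}$, $\bar\mu_\Gamma(\bar b/{\sim_\Gamma})=\mu_\Gamma(\bar b)$. **Translations.** A formula is in normal form if it is prenex and its matrix is a disjunction of conjunctions of unnested atomic formulas ($x=x'$, $x=c$, $f(x_1,\ldots,x_{n_f})=x_0$,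 $R(x_1,\ldots,x_{n_R})$) and their negations. For an $L(\mathbb{A})$-formula $\psi(x_1,\ldots,x_s)$ in normal form, $\psi_\Gamma(\bar x_1,\ldots,\bar x_s,\bar y)$ is the $L(\mathbb{B})$-formula obtained by replacing each variable by a tuple of $\dim\Gamma$ variables, replacing the unnested atomic formulas by $E_\Gamma,c_\Gamma,f_\Gamma,R_\Gamma$ respectively, relativizing all quantifiers to $U_\Gamma(\cdot,\bar y)$, and adding the conjuncts $U_\Gamma(\bar x_i,\bar y)$ for all listed free variables. A formula not in normal form is translated via a logically equivalent normal form. **Composition.** For codes $\Gamma\colon L(\mathbb{A})\to L(\mathbb{B})$ and $\Delta\colon L(\mathbb{B})\to L(\mathbb{C})$, the code $\Gamma\circ\Delta\colon L(\mathbb{A})\to L(\mathbb{C})$ consists of the $\Delta$-translations $(U_\Gamma)_\Delta,(E_\Gamma)_\Delta,(c_\Gamma)_\Delta,(f_\Gamma)_\Delta,(R_\Gamma)_\Delta$; $\dim\Gamma\circ\Delta=\dim\Gamma\cdot\dim\Delta$, $\dim_{\mathrm{par}}\Gamma\circ\Delta=\dim_{\mathrm{par}}\Gamma\cdot\dim\Delta+\dim_{\mathrm{par}}\Delta$. The composition of interpretations $(\Gamma,\bar p,\mu_\Gamma)\colon\mathbb{A}\rightsquigarrow\mathbb{B}$ and $(\Delta,\bar q,\mu_\Delta)\colon\mathbb{B}\rightsquigarrow\mathbb{C}$ is the interpretation $(\Gamma\circ\Delta,(\bar{\bar p},\bar q),\mu_\Gamma\circ\mu_\Delta)\colon\mathbb{A}\rightsquigarrow\mathbb{C}$,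 where $\bar{\bar p}\in\mu_\Delta^{-1}(\bar p)$ (any choice). The identical interpretation of $\mathbb{A}$ in $\mathbb{A}$ is $(\mathbf{Id}_{L(\mathbb{A})},\emptyset,\mathrm{id}_A)$, where $\mathbf{Id}_{L(\mathbb{A})}$ has dimension 1, no parameters, $U$ is $x=x$, $E$ is $x=x'$, and symbols are coded by $x=c$, $f(x_1,\ldots,x_{n_f})=x_0$, $R(x_1,\ldots,x_{n_R})$. **Strong homotopy.** Interpretations $(\Gamma_1,\bar p_1,\mu_{\Gamma_1}),(\Gamma_2,\bar p_2,\mu_{\Gamma_2})\colon\mathbb{A}\rightsquigarrow\mathbb{B}$ are strongly homotopic if there is an $L(\mathbb{A})$-isomorphism $\lambda\colon\Gamma_1(\mathbb{B},\bar p_1)\to\Gamma_2(\mathbb{B},\bar p_2)$ with $\bar\mu_{\Gamma_1}=\bar\mu_{\Gamma_2}\circ\lambda$ which is definable in $\mathbb{B}$ (the preimage of its graph is definable by a formula of $L(\mathbb{B})\cup B$). They are absolutely strongly homotopic if the codes are absolute and $\lambda$ is definable by a formula of $L(\mathbb{B})$ without parameters. **Bi-interpretations.** A strong bi-interpretation between $\mathbb{A}$ and $\mathbb{B}$ consists of interpretations $(\Gamma,\bar p,\mu_\Gamma)\colon\mathbb{A}\rightsquigarrow\mathbb{B}$ and $(\Delta,\bar q,\mu_\Delta)\colon\mathbb{B}\rightsquigarrow\mathbb{A}$ such that $(\Gamma\circ\Delta,(\bar{\bar p},\bar q),\mu_\Gamma\circ\mu_\Delta)$ is strongly homotopic to $(\mathbf{Id}_{L(\mathbb{A})},\emptyset,\mathrm{id}_A)$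 and $(\Delta\circ\Gamma,(\bar{\bar q},\bar p),\mu_\Delta\circ\mu_\Gamma)$ is strongly homotopic to $(\mathbf{Id}_{L(\mathbb{B})},\emptyset,\mathrm{id}_B)$. It is injective if $\Gamma,\Delta$ are injective; absolute if $\Gamma,\Delta$ are absolute and both strong homotopies are absolute. Structures are strongly (injectively, absolutely, absolutely injectively) bi-interpretable if such a bi-interpretation exists. Two interpretations $(\Gamma_1,\bar p_1,\mu_{\Gamma_1}),(\Gamma_2,\bar p_2,\mu_{\Gamma_2})\colon\mathbb{A}\rightsquigarrow\mathbb{B}$ are equal if $\Gamma_1(\mathbb{B},\bar p_1)=\Gamma_2(\mathbb{B},\bar p_2)$ and $\mu_{\Gamma_1}=\mu_{\Gamma_2}$. $\mathbb{A}$ and $\mathbb{B}$ are syntactically isomorphic if there is a strong bi-interpretation between $\mathbb{A}$ and $\mathbb{B}$, consisting of interpretations $(\Gamma,\bar p,\mu_\Gamma)\colon\mathbb{A}\rightsquigarrow\mathbb{B}$ and $(\Delta,\bar q,\mu_\Delta)\colon\mathbb{B}\rightsquigarrow\mathbb{A}$, in which the composition $(\Gamma\circ\Delta,(\bar{\bar p},\bar q),\mu_\Gamma\circ\mu_\Delta)$ is equal to $(\mathbf{Id}_{L(\mathbb{A})},\emptyset,\mathrm{id}_A)$ and the composition $(\Delta\circ\Gamma,(\bar{\bar q},\bar p),\mu_\Delta\circ\mu_\Gamma)$ is equal to $(\mathbf{Id}_{L(\mathbb{B})},\emptyset,\mathrm{id}_B)$. *)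

(* Defs.v *)
From mathcomp Require Import all_boot matrix.
From mathcomp Require Import boolp.
From Stdlib Require Import RelationClasses.

Set Implicit Arguments.
Unset Strict Implicit.
Unset Printing Implicit Defensive.

Definition cons_tup T n (x : T) (xs : 'I_n -> T) : 'I_n.+1 -> T :=
  fun i => if unlift ord0 i is Some j then xs j else x.

Definition pair_tup T (x y : T) : 'I_2 -> T := cons_tup x (fun _ : 'I_1 => y).

Definition cat_tup T m n (x : 'I_m -> T) (y : 'I_n -> T) : 'I_(m + n) -> T :=
  fun i => match split i with inl j => x j | inr j => y j end.

Definition nil_tup T : 'I_0 -> T.
Proof. by case. Defined.

(* The i-th of the n successive blocks of length m of an (n * m)-tuple. *)
Definition block T n m (x : 'I_(n * m) -> T) (i : 'I_n) : 'I_m -> T :=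
  fun j => x (mxvec_index i j).

Record language := Language {
  const : Type;
  func : Type;
  farity : func -> nat;
  predicate : Type;
  parity : predicate -> nat }.

Record structure (L : language) := Structure {
  carrier :> Type;
  carrier_nonempty : inhabited carrier;
  cst_in : const L -> carrier;
  fun_in : forall f : func L, ('I_(farity f) -> carrier) -> carrier;
  pred_in : forall R : predicate L, ('I_(parity R) -> carrier) -> Prop }.

Arguments cst_in [L] _ _.
Arguments fun_in [L] _ _ _.
Arguments pred_in [L] _ _ _.

Section Syntax.

Variable L : language.

(* Terms and formulas whose free variables are among the elements of V; under
   a quantifier, None is the bound variable and Some x is the old x. *)
Inductive term (V : Type) : Type :=
| Var of V
| Cst of const L
| App (f : func L) of 'I_(farity f) -> term V.

Inductive formula (V : Type) : Type :=
| Top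
| Eq of term V & term V
| Pred (R : predicate L) of 'I_(parity R) -> term V
| Not of formula V
| And of formula V & formula V
| Or of formula V & formula V
| Imp of formula V & formula V
| All of formula (option V)
| Ex of formula (option V).

Arguments Var {V} _.
Arguments Cst {V} _.
Arguments Top {V}.
Arguments Pred {V} R _.

Fixpoint term_rename (V W : Type) (h : V -> W) (t : term V) : term W :=
  match t with
  | Var x => Var (h x)
  | Cst c => Cst c
  | App f ts => App (fun i => term_rename h (ts i))
  end.

Fixpoint rename (V W : Type) (h : V -> W) (phi : formula V) : formula W :=
  match phi with
  | Top => Top
  | Eq t u => Eq (term_rename h t) (term_rename h u)
  | Pred R ts => Pred R (fun i => term_rename h (ts i))
  | Not p => Not (rename h p)
  | And p q => And (rename h p) (rename h q)
  | Or p q => Or (rename h p) (rename h q)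
  | Imp p q => Imp (rename h p) (rename h q)
  | All p => All (rename (omap h) p)
  | Ex p => Ex (rename (omap h) p)
  end.

(* Quantification over m variables at once, by m quantifiers. *)
Definition peel V m (x : V + 'I_m.+1) : option V + 'I_m :=
  match x with
  | inl v => inl (Some v)
  | inr i => if unlift ord0 i is Some j then inr j else inl None
  end.

Definition unpeel V (x : V + 'I_0) : V :=
  match x with inl v => v | inr i => nil_tup V i end.

Fixpoint alls m (V : Type) : formula (V + 'I_m) -> formula V :=
  match m with
  | 0 => rename (@unpeel V)
  | m'.+1 => fun phi => All (alls (rename (@peel V m') phi))
  end.

Fixpoint exs m (V : Type) : formula (V + 'I_m) -> formula V :=
  match m with
  | 0 => rename (@unpeel V)
  | m'.+1 => fun phi => Ex (exs (rename (@peel V m') phi))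
  end.

Definition conjunction V (s : seq (formula V)) : formula V :=
  if s is phi :: s' then foldl (@And V) phi s' else Top.

Fixpoint eval (M : structure L) (V : Type) (v : V -> M) (t : term V) : M :=
  match t with
  | Var x => v x
  | Cst c => cst_in M c
  | App f ts => fun_in M f (fun i => eval v (ts i))
  end.

Definition push T V (v : V -> T) (a : T) : option V -> T :=
  fun x => if x is Some y then v y else a.

Fixpoint sat (M : structure L) (V : Type) (phi : formula V) : (V -> M) -> Prop :=
  match phi with
  | Top => fun _ => True
  | Eq t u => fun v => eval v t = eval v u
  | Pred R ts => fun v => pred_in M R (fun i => eval v (ts i))
  | Not p => fun v => ~ sat p v
  | And p q => fun v => sat p v /\ sat q v
  | Or p q => fun v => sat p v \/ sat q v
  | Imp p q => fun v => sat p v -> sat q v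
  | All p => fun v => forall a, sat p (push v a)
  | Ex p => fun v => exists a, sat p (push v a)
  end.

Definition logically_equivalent V (phi psi : formula V) : Prop :=
  forall (M : structure L) (v : V -> M), sat phi v <-> sat psi v.

Inductive unnested (V : Type) : Type :=
| UEq of V & V
| UCst of V & const L
| UFun (f : func L) of 'I_(farity f) -> V & V
| UPred (R : predicate L) of 'I_(parity R) -> V.

Arguments UPred {V} R _.

Inductive conjunct (V : Type) : Type :=
| CPos of unnested V
| CNeg of unnested V
| CAnd of conjunct V & conjunct V.

Inductive dnf (V : Type) : Type :=
| DConj of conjunct V
| DOr of dnf V & dnf V.

Inductive normal_form (V : Type) : Type :=
| NMatrix of dnf V
| NAll of normal_form (option V)
| NEx of normal_form (option V).

Definition unnested_formula V (a : unnested V) : formula V :=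
  match a with
  | UEq x y => Eq (Var x) (Var y)
  | UCst x c => Eq (Var x) (Cst c)
  | UFun f xs x0 => Eq (App (fun i => Var (xs i))) (Var x0)
  | UPred R xs => Pred R (fun i => Var (xs i))
  end.

Fixpoint conjunct_formula V (c : conjunct V) : formula V :=
  match c with
  | CPos a => unnested_formula a
  | CNeg a => Not (unnested_formula a)
  | CAnd c1 c2 => And (conjunct_formula c1) (conjunct_formula c2)
  end.

Fixpoint dnf_formula V (d : dnf V) : formula V :=
  match d with
  | DConj c => conjunct_formula c
  | DOr d1 d2 => Or (dnf_formula d1) (dnf_formula d2)
  end.

Fixpoint nf_formula (V : Type) (n : normal_form V) : formula V :=
  match n with
  | NMatrix d => dnf_formula d
  | NAll n' => All (nf_formula n')
  | NEx n' => Ex (nf_formula n')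
  end.

Lemma eval_rename (M : structure L) V W (h : V -> W) (t : term V) (v : W -> M) :
  eval v (term_rename h t) = eval (v \o h) t.
Proof. by elim: t => //= f ts IH; congr fun_in; apply: funext. Qed.

Lemma push_omap T V W (h : V -> W) (v : W -> T) a :
  push v a \o omap h = push (v \o h) a.
Proof. by apply: funext; case. Qed.

Lemma sat_rename (M : structure L) V W (h : V -> W) (phi : formula V)
    (v : W -> M) :
  sat (rename h phi) v <-> sat phi (v \o h).
Proof.
elim: phi W h v => //=.
- by move=> ? t u W h v; rewrite !eval_rename.
- move=> ? R ts W h v; suff -> : (fun i => eval v (term_rename h (ts i))) =
    (fun i => eval (v \o h) (ts i)) by [].
  by apply: funext => i; rewrite eval_rename.
- by move=> ? p IH W h v; rewrite IH.
- by move=> ? p IHp q IHq W h v; rewrite IHp IHq.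
- by move=> ? p IHp q IHq W h v; rewrite IHp IHq.
- by move=> ? p IHp q IHq W h v; rewrite IHp IHq.
- move=> ? p IH W h v; split=> H a; have := H a;
    by rewrite IH push_omap.
- move=> ? p IH W h v; split=> -[a H]; exists a; move: H;
    by rewrite IH push_omap.
Qed.

Definition val_sum T V m (v : V -> T) (b : 'I_m -> T) : V + 'I_m -> T :=
  fun x => match x with inl y => v y | inr i => b i end.

Lemma val_sum_unpeel T V (v : V -> T) (b : 'I_0 -> T) :
  v \o @unpeel V = val_sum v b.
Proof. by apply: funext => -[//|[]]. Qed.

Lemma val_sum_peel T V m (v : V -> T) a (b : 'I_m -> T) :
  val_sum (push v a) b \o @peel V m = val_sum v (cons_tup a b).
Proof.
by apply: funext => -[//|i] /=; rewrite /cons_tup; case: unliftP.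
Qed.

Lemma cons_tupK T m (b : 'I_m.+1 -> T) :
  cons_tup (b ord0) (fun j => b (lift ord0 j)) = b.
Proof. by apply: funext => i; rewrite /cons_tup; case: unliftP => [j|] ->. Qed.

Lemma sat_alls (M : structure L) m V (phi : formula (V + 'I_m)) (v : V -> M) :
  sat (alls phi) v <-> forall b, sat phi (val_sum v b).
Proof.
elim: m V phi v => [|m IH] V phi v /=.
  rewrite sat_rename; split=> [H b|/(_ (nil_tup M))]; first by
    rewrite -val_sum_unpeel.
  by rewrite -val_sum_unpeel.
split=> [H b|H a].
  have := H (b ord0); rewrite IH => /(_ (fun j => b (lift ord0 j))).
  by rewrite sat_rename val_sum_peel cons_tupK.
by rewrite IH => b; rewrite sat_rename val_sum_peel.
Qed.

Lemma sat_exs (M : structure L) m V (phi : formula (V + 'I_m)) (v : V -> M) :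
  sat (exs phi) v <-> exists b, sat phi (val_sum v b).
Proof.
elim: m V phi v => [|m IH] V phi v /=.
  rewrite sat_rename; split=> [H|[b]]; last by rewrite -val_sum_unpeel.
  by exists (nil_tup M); rewrite -val_sum_unpeel.
split=> [[a]|[b H]].
  by rewrite IH => -[b]; rewrite sat_rename val_sum_peel => H; eexists; exact: H.
exists (b ord0); rewrite IH; exists (fun j => b (lift ord0 j)).
by rewrite sat_rename val_sum_peel cons_tupK.
Qed.

Definition unnested_rename V W (h : V -> W) (a : unnested V) : unnested W :=
  match a with
  | UEq x y => UEq (h x) (h y)
  | UCst x c => UCst (h x) c
  | UFun f xs x0 => UFun (fun i => h (xs i)) (h x0)
  | UPred R xs => UPred R (fun i => h (xs i))
  end.

Fixpoint conjunct_rename V W (h : V -> W) (c : conjunct V) : conjunct W :=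
  match c with
  | CPos a => CPos (unnested_rename h a)
  | CNeg a => CNeg (unnested_rename h a)
  | CAnd c1 c2 => CAnd (conjunct_rename h c1) (conjunct_rename h c2)
  end.

Fixpoint dnf_rename V W (h : V -> W) (d : dnf V) : dnf W :=
  match d with
  | DConj c => DConj (conjunct_rename h c)
  | DOr d1 d2 => DOr (dnf_rename h d1) (dnf_rename h d2)
  end.

Fixpoint nf_rename (V W : Type) (h : V -> W) (n : normal_form V) :
    normal_form W :=
  match n with
  | NMatrix d => NMatrix (dnf_rename h d)
  | NAll n' => NAll (nf_rename (omap h) n')
  | NEx n' => NEx (nf_rename (omap h) n')
  end.

Lemma nf_formula_rename (V W : Type) (h : V -> W) (n : normal_form V) :
  nf_formula (nf_rename h n) = rename h (nf_formula n).
Proof.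
elim: n W h => /= [{}V d|{}V n IH|{}V n IH] W h; last 2 first.
- by rewrite IH.
- by rewrite IH.
elim: d => /= [c|d1 -> d2 -> //].
by elim: c => /= [[]|[]|c1 -> c2 ->].
Qed.

Definition has_nf (V : Type) (phi : formula V) : Prop :=
  exists n : normal_form V, logically_equivalent (nf_formula n) phi.

Lemma has_nf_equiv V (phi psi : formula V) :
  logically_equivalent phi psi -> has_nf phi -> has_nf psi.
Proof. by move=> e [n en]; exists n => M v; rewrite en. Qed.

Lemma has_nf_rename V W (h : V -> W) phi : has_nf phi -> has_nf (rename h phi).
Proof.
move=> [n en]; exists (nf_rename h n) => M v.
by rewrite nf_formula_rename !sat_rename.
Qed.

Lemma has_nf_all V (phi : formula (option V)) : has_nf phi -> has_nf (All phi).
Proof. by move=> [n en]; exists (NAll n) => M v /=; split=> H a; apply/en. Qed.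

Lemma has_nf_ex V (phi : formula (option V)) : has_nf phi -> has_nf (Ex phi).
Proof.
by move=> [n en]; exists (NEx n) => M v /=; split=> -[a /en H]; exists a.
Qed.

Lemma has_nf_exs m V (phi : formula (V + 'I_m)) : has_nf phi -> has_nf (exs phi).
Proof.
elim: m V phi => [|m IH] V phi H /=; first exact: has_nf_rename.
by apply/has_nf_ex/IH/has_nf_rename.
Qed.

Lemma dnf_and V (d1 d2 : dnf V) : exists d : dnf V,
  logically_equivalent (dnf_formula d) (And (dnf_formula d1) (dnf_formula d2)).
Proof.
elim: d1 d2 => [c1|d1 IH1 d1' IH1'] d2.
  elim: d2 => [c2|d2 [d e] d2' [d' e']]; first by exists (DConj (CAnd c1 c2)).
  by exists (DOr d d') => M v /=; rewrite e e' /=; tauto.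
have [d e] := IH1 d2; have [d' e'] := IH1' d2.
by exists (DOr d d') => M v /=; rewrite e e' /=; tauto.
Qed.

Lemma dnf_not V (d : dnf V) : exists d' : dnf V,
  logically_equivalent (dnf_formula d') (Not (dnf_formula d)).
Proof.
elim: d => [c|d1 [d1' e1] d2 [d2' e2]].
  elim: c => [a|a|c1 [d1 e1] c2 [d2 e2]]; first by exists (DConj (CNeg a)).
    by exists (DConj (CPos a)) => M v /=; rewrite not_notE.
  by exists (DOr d1 d2) => M v /=; rewrite e1 e2 /= not_andE.
have [d e] := dnf_and d1' d2'.
by exists d => M v; rewrite e /= e1 e2 /=; tauto.
Qed.

Lemma has_nf_not V (phi : formula V) : has_nf phi -> has_nf (Not phi).
Proof.
move=> [n en]; apply: (@has_nf_equiv _ (Not (nf_formula n))).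
  by move=> M v /=; rewrite en.
elim: n {phi en} => [{}V d|{}V n IH|{}V n IH].
- by have [d' e] := dnf_not d; exists (NMatrix d').
- apply: has_nf_equiv (has_nf_ex IH) => M v /=.
  by rewrite -existsNE.
- apply: has_nf_equiv (has_nf_all IH) => M v /=.
  by rewrite -forallNE.
Qed.

Lemma has_nf_and V (phi psi : formula V) :
  has_nf phi -> has_nf psi -> has_nf (And phi psi).
Proof.
move=> [n en] [m em].
apply: (@has_nf_equiv _ (And (nf_formula n) (nf_formula m))).
  by move=> M v /=; rewrite en em.
have shift W (chi : formula W) (M : structure L) (v : W -> M) a :
    sat (rename Some chi) (push v a) <-> sat chi v by rewrite sat_rename.
elim: n m {phi psi en em} => [{}V d|{}V n IH|{}V n IH] m.
- elim: m d => [{}V d'|{}V m IH|{}V m IH] d.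
  + by have [d0 e] := dnf_and d d'; exists (NMatrix d0).
  + apply: has_nf_equiv (has_nf_all (IH (dnf_rename Some d))) => M v /=.
    have [a0] := carrier_nonempty M.
    rewrite -!/(nf_formula (NMatrix _)) -/(nf_rename Some (NMatrix d)).
    rewrite nf_formula_rename; split=> [H|[Hd H] a].
      by split=> [|a]; [have [/shift] := H a0 | have [] := H a].
    by split; [apply/shift | exact: H].
  + apply: has_nf_equiv (has_nf_ex (IH (dnf_rename Some d))) => M v /=.
    rewrite -!/(nf_formula (NMatrix _)) -/(nf_rename Some (NMatrix d)).
    rewrite nf_formula_rename; split=> [[a [/shift Hd H]]|[Hd [a H]]].
      by split=> //; exists a.
    by exists a; split=> //; apply/shift.
- apply: has_nf_equiv (has_nf_all (IH (nf_rename Some m))) => M v /=.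
  have [a0] := carrier_nonempty M.
  rewrite nf_formula_rename; split=> [H|[H Hm] a].
    by split=> [a|]; [have [] := H a | have [_ /shift] := H a0].
  by split; [exact: H | apply/shift].
- apply: has_nf_equiv (has_nf_ex (IH (nf_rename Some m))) => M v /=.
  rewrite nf_formula_rename; split=> [[a [H /shift Hm]]|[[a H] Hm]].
    by split=> //; exists a.
  by exists a; split=> //; apply/shift.
Qed.

Lemma has_nf_or V (phi psi : formula V) :
  has_nf phi -> has_nf psi -> has_nf (Or phi psi).
Proof.
move=> /has_nf_not Hp /has_nf_not Hq.
apply: has_nf_equiv (has_nf_not (has_nf_and Hp Hq)) => M v /=.
by rewrite not_andE !not_notE.
Qed.

Lemma has_nf_imp V (phi psi : formula V) :
  has_nf phi -> has_nf psi -> has_nf (Imp phi psi).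
Proof.
move=> /has_nf_not Hp Hq; apply: has_nf_equiv (has_nf_or Hp Hq) => M v /=.
by rewrite implyE.
Qed.

Lemma has_nf_unnested V (a : unnested V) : has_nf (unnested_formula a).
Proof. by exists (NMatrix (DConj (CPos a))). Qed.

Lemma has_nf_top V : has_nf (@Top V).
Proof.
apply: has_nf_equiv (has_nf_ex (has_nf_unnested (UEq None None))) => M v /=.
by have [a] := carrier_nonempty M; split=> // _; exists a.
Qed.

Lemma sat_conjunction (M : structure L) V (s : seq (formula V)) (v : V -> M) :
  sat (conjunction s) v <-> foldr (fun phi P => sat phi v /\ P) True s.
Proof.
case: s => //= phi s; elim: s phi => /= [|psi s IH] phi; first by tauto.
by rewrite IH /=; tauto.
Qed.

Lemma has_nf_conjunction V (s : seq (formula V)) :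
  foldr (fun phi P => has_nf phi /\ P) True s -> has_nf (conjunction s).
Proof.
case: s => [_|phi s [H Hs]]; first exact: has_nf_top.
rewrite /=; elim: s phi H Hs => //= psi s IH phi H [Hpsi Hs].
by apply: IH => //; apply: has_nf_and.
Qed.

Lemma has_nf_flatten m V (ts : 'I_m -> term V) psi (phi : formula V) :
  (forall i, has_nf (Eq (term_rename (@inl V 'I_m) (ts i)) (Var (inr i)))) ->
  has_nf psi ->
  (forall (M : structure L) (v : V -> M),
     sat psi (val_sum v (fun i => eval v (ts i))) <-> sat phi v) ->
  has_nf phi.
Proof.
move=> Harg Hpsi e.
pose arg i := Eq (term_rename (@inl V 'I_m) (ts i)) (Var (inr i)).
have Hchi : has_nf (And (conjunction (map arg (enum 'I_m))) psi).
  apply: has_nf_and Hpsi; apply: has_nf_conjunction.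
  by elim: (enum _) => //= i s IHs; split=> //; exact: Harg.
apply: has_nf_equiv (has_nf_exs Hchi) => M v; rewrite sat_exs /=.
have argE b i : sat (arg i) (val_sum v b) <-> eval v (ts i) = b i.
  by rewrite /= eval_rename.
have argsE b : sat (conjunction (map arg (enum 'I_m))) (val_sum v b) <->
    forall i, eval v (ts i) = b i.
  rewrite sat_conjunction; split=> [H i|H]; last first.
    by elim: (enum _) => //= i s IHs; split=> //; apply/argE.
  have: i \in enum 'I_m by rewrite mem_enum.
  elim: (enum _) H => //= j s IHs [Hj /IHs Hs].
  by rewrite in_cons => /orP[/eqP ->|/Hs //]; apply/argE.
split=> [[b [/argsE Hb]]|H].
  have -> : b = (fun i => eval v (ts i)) by apply: funext.
  by move/e.
by exists (fun i => eval v (ts i)); split; [apply/argsE | apply/e].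
Qed.

Lemma has_nf_term V (t : term V) W (h : V -> W) (x : W) :
  has_nf (Eq (term_rename h t) (Var x)).
Proof.
elim: t W h x => [y|c|f ts IH] W h x.
- exact: (has_nf_unnested (UEq (h y) x)).
- by apply: has_nf_equiv (has_nf_unnested (UCst x c)) => M v /=; split=> ->.
apply: (has_nf_flatten (ts := fun i => term_rename h (ts i))
  (psi := unnested_formula (@UFun (W + 'I_(farity f)) f inr (inl x)))) => //.
  move=> i; apply: has_nf_equiv (IH i _ (inl \o h) (inr i)) => M v /=.
  by rewrite !eval_rename.
exact: has_nf_unnested.
Qed.

Lemma has_nf_formula V (phi : formula V) : has_nf phi.
Proof.
elim: phi => {}V.
- exact: has_nf_top.
- move=> t u.
  have := has_nf_and (has_nf_term t Some None) (has_nf_term u Some None).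
  move=> /has_nf_ex; apply: has_nf_equiv => M v /=; split=> [[a]|e].
    by rewrite !eval_rename => -[-> ->].
  by exists (eval v t); rewrite !eval_rename.
- move=> R ts; apply: (has_nf_flatten (ts := ts)
    (psi := unnested_formula (@UPred (V + 'I_(parity R)) R inr))) => //.
    by move=> i; exact: has_nf_term.
  exact: has_nf_unnested.
- by move=> p; exact: has_nf_not.
- by move=> p Hp q; exact: has_nf_and.
- by move=> p Hp q; exact: has_nf_or.
- by move=> p Hp q; exact: has_nf_imp.
- by move=> p; exact: has_nf_all.
- by move=> p; exact: has_nf_ex.
Qed.

Lemma normal_form_exists V (phi : formula V) :
  exists n, logically_equivalent (nf_formula n) phi /\
    ((exists n', nf_formula n' = phi) -> nf_formula n = phi).
Proof.
have [[n e]|N] := pselect (exists n', nf_formula n' = phi).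
  by exists n; rewrite e.
by have [n e] := has_nf_formula phi; exists n.
Qed.

(* Some normal form of phi, which is phi itself whenever phi is in normal
   form. *)
Definition to_nf V (phi : formula V) : normal_form V :=
  sval (cid (normal_form_exists phi)).

End Syntax.

Arguments Top {L V}.
Arguments Var {L V} _.
Arguments Cst {L V} _.
Arguments App {L V} f _.
Arguments Pred {L V} R _.

(* Variables of a formula about r tuples of length d and a parameter tuple of
   length k. *)
Definition code_vars (d k r : nat) : finType := ('I_r * 'I_d + 'I_k)%type.

Definition code_val T d k r (bs : 'I_r -> 'I_d -> T) (p : 'I_k -> T) :
    code_vars d k r -> T :=
  fun z => match z with inl ij => bs ij.1 ij.2 | inr l => p l end.

(* In [code_fun], the tuple of index 0 is the value. *)
Record code (L K : language) := Code {
  dim : nat;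
  pardim : nat;
  code_dom : formula K (code_vars dim pardim 1);
  code_eq : formula K (code_vars dim pardim 2);
  code_cst : const L -> formula K (code_vars dim pardim 1);
  code_fun : forall f : func L, formula K (code_vars dim pardim (farity f).+1);
  code_pred : forall R : predicate L, formula K (code_vars dim pardim (parity R)) }.

Definition tuple_eq K d k : formula K (code_vars d k 2) :=
  conjunction [seq Eq (Var (inl (ord0, j))) (Var (inl (ord_max, j)))
              | j <- enum 'I_d].

Definition injective_code L K (G : code L K) : Prop :=
  code_eq G = tuple_eq K (dim G) (pardim G).

Definition absolute_code L K (G : code L K) : Prop := pardim G = 0.

Definition id_code (L : language) : code L L := {|
  dim := 1;
  pardim := 0;
  code_dom := Eq (Var (inl (ord0, ord0))) (Var (inl (ord0, ord0)));
  code_eq := Eq (Var (inl (ord0, ord0))) (Var (inl (ord_max, ord0)));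
  code_cst := fun c => Eq (Var (inl (ord0, ord0))) (Cst c);
  code_fun := fun f => Eq (App f (fun i => Var (inl (lift ord0 i, ord0))))
                          (Var (inl (ord0, ord0)));
  code_pred := fun R => Pred R (fun i => Var (inl (i, ord0))) |}.

Section Translation.

Variables (L K : language) (G : code L K).
Let d := dim G.
Let k := pardim G.

Definition place r V (xs : 'I_r -> V) (z : code_vars d k r) : V * 'I_d + 'I_k :=
  match z with inl ij => inl (xs ij.1, ij.2) | inr l => inr l end.

Definition dom_at V (x : V) : formula K (V * 'I_d + 'I_k) :=
  rename (place (fun=> x)) (code_dom G).

Definition translate_unnested V (a : unnested L V) :
    formula K (V * 'I_d + 'I_k) :=
  match a with
  | UEq x y => rename (place (pair_tup x y)) (code_eq G)
  | UCst x c => rename (place (fun=> x)) (code_cst G c)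
  | UFun f xs x0 => rename (place (cons_tup x0 xs)) (code_fun G f)
  | UPred R xs => rename (place xs) (code_pred G R)
  end.

Fixpoint translate_conjunct V (c : conjunct L V) : formula K (V * 'I_d + 'I_k) :=
  match c with
  | CPos a => translate_unnested a
  | CNeg a => Not (translate_unnested a)
  | CAnd c1 c2 => And (translate_conjunct c1) (translate_conjunct c2)
  end.

Fixpoint translate_dnf V (e : dnf L V) : formula K (V * 'I_d + 'I_k) :=
  match e with
  | DConj c => translate_conjunct c
  | DOr e1 e2 => Or (translate_dnf e1) (translate_dnf e2)
  end.

(* Isolates the tuple of variables that translates the innermost bound
   variable. *)
Definition expose V (z : option V * 'I_d + 'I_k) : V * 'I_d + 'I_k + 'I_d :=
  match z with
  | inl (Some x, j) => inl (inl (x, j))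
  | inl (None, j) => inr j
  | inr l => inl (inr l)
  end.

Fixpoint translate_nf (V : Type) (n : normal_form L V) :
    formula K (V * 'I_d + 'I_k) :=
  match n with
  | NMatrix e => translate_dnf e
  | NAll n' => alls (rename (@expose V) (Imp (dom_at None) (translate_nf n')))
  | NEx n' => exs (rename (@expose V) (And (dom_at None) (translate_nf n')))
  end.

Definition translate (V : finType) (phi : formula L V) :
    formula K (V * 'I_d + 'I_k) :=
  conjunction (rcons [seq dom_at x | x <- enum V] (translate_nf (to_nf phi))).

End Translation.

Section Composition.

Variables (LA LB LC : language) (G : code LA LB) (D : code LB LC).

Definition comp_var r (z : code_vars (dim G) (pardim G) r * 'I_(dim D) + 'I_(pardim D)) :
    code_vars (dim G * dim D) (pardim G * dim D + pardim D) r :=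
  match z with
  | inl (inl (i, j), j') => inl (i, mxvec_index j j')
  | inl (inr l, j') => inr (lshift (pardim D) (mxvec_index l j'))
  | inr l => inr (rshift (pardim G * dim D) l)
  end.

Definition comp_formula r (phi : formula LB (code_vars (dim G) (pardim G) r)) :
    formula LC (code_vars (dim G * dim D) (pardim G * dim D + pardim D) r) :=
  rename (@comp_var r) (translate D phi).

Definition comp_code : code LA LC := {|
  dim := dim G * dim D;
  pardim := pardim G * dim D + pardim D;
  code_dom := comp_formula (code_dom G);
  code_eq := comp_formula (code_eq G);
  code_cst := fun c => comp_formula (code_cst G c);
  code_fun := fun f => comp_formula (code_fun G f);
  code_pred := fun R => comp_formula (code_pred G R) |}.

End Composition.

Section CodedStructure.

Variables (L K : language) (G : code L K) (B : structure K).
Variable p : 'I_(pardim G) -> B.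

Definition in_dom (b : 'I_(dim G) -> B) : Prop :=
  sat (code_dom G) (code_val (fun=> b) p).

Definition dom : Type := {b | in_dom b}.

Definition code_rel (b b' : dom) : Prop :=
  sat (code_eq G) (code_val (pair_tup (sval b) (sval b')) p).

(* Equivalence classes are represented by predicates on dom. *)
Definition quotient : Type := {S : dom -> Prop | exists b, S = code_rel b}.

Definition class (b : dom) : quotient := exist _ (code_rel b) (ex_intro _ b erefl).

Record well_defined : Prop := WellDefined {
  wd_dom : inhabited dom;
  wd_equiv : Equivalence code_rel;
  wd_cst : forall c, exists q : quotient, forall b : dom,
    sat (code_cst G c) (code_val (fun=> sval b) p) <-> class b = q;
  wd_fun : forall f, exists g : ('I_(farity f) -> quotient) -> quotient,
    forall (b0 : dom) (bs : 'I_(farity f) -> dom),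
    sat (code_fun G f) (code_val (cons_tup (sval b0) (fun i => sval (bs i))) p)
      <-> class b0 = g (fun i => class (bs i));
  wd_pred : forall R, exists r : ('I_(parity R) -> quotient) -> Prop,
    forall bs : 'I_(parity R) -> dom,
    sat (code_pred G R) (code_val (fun i => sval (bs i)) p)
      <-> r (fun i => class (bs i)) }.

Lemma quotient_nonempty (w : well_defined) : inhabited quotient.
Proof. by have [b] := wd_dom w; exists; exact: class b. Qed.

(* The objects selected by cid are uniquely determined. *)
Definition coded_structure (w : well_defined) : structure L := {|
  carrier := quotient;
  carrier_nonempty := quotient_nonempty w;
  cst_in := fun c => sval (cid (wd_cst w c));
  fun_in := fun f => sval (cid (wd_fun w f));
  pred_in := fun R => sval (cid (wd_pred w R)) |}.

End CodedStructure.

Definition isomorphism L (M N : structure L) (h : M -> N) : Prop :=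
  [/\ bijective h,
      forall c, h (cst_in M c) = cst_in N c,
      forall f xs, h (fun_in M f xs) = fun_in N f (fun i => h (xs i)) &
      forall R xs, pred_in M R xs <-> pred_in N R (fun i => h (xs i))].

(* The coordinate map is a total function on tuples, only its values on the
   domain of the code being relevant. *)
Record triple L K (A : structure L) (B : structure K) := Triple {
  tcode : code L K;
  tpar : 'I_(pardim tcode) -> B;
  tmap : ('I_(dim tcode) -> B) -> A }.

Arguments tcode {L K A B} t.
Arguments tpar {L K A B} t _.
Arguments tmap {L K A B} t _.

Definition language_with (K : language) (B : Type) : language := {|
  const := const K + B;
  func := func K;
  farity := @farity K;
  predicate := predicate K;
  parity := @parity K |}.

Definition structure_with K (B : structure K) : structure (language_with K B) :=
  @Structure (language_with K B) B (carrier_nonempty B)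
    (fun c => match c with inl c' => cst_in B c' | inr b => b end)
    (fun_in B) (pred_in B).

Definition definable K (B : structure K) m n
    (Q : ('I_m -> B) -> ('I_n -> B) -> Prop) : Prop :=
  exists phi : formula (language_with K B) ('I_m + 'I_n),
  forall x y, sat (M := structure_with B) phi (val_sum x y) <-> Q x y.

Definition absolutely_definable K (B : structure K) m n
    (Q : ('I_m -> B) -> ('I_n -> B) -> Prop) : Prop :=
  exists phi : formula K ('I_m + 'I_n),
  forall x y, sat phi (val_sum x y) <-> Q x y.

Section Interpretations.

Variables (L K : language) (A : structure L) (B : structure K).
Implicit Types I : triple A B.

Definition induced_iso I (w : well_defined (tpar I)) (m : coded_structure w -> A) :
    Prop :=
  isomorphism m /\ forall b, m (class b) = tmap I (sval b).

Definition interpretation I : Prop :=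
  (forall a, exists b : dom (tpar I), tmap I (sval b) = a) /\
  exists (w : well_defined (tpar I)) (m : coded_structure w -> A), induced_iso m.

Definition graph_preimage I1 I2 (w1 : well_defined (tpar I1))
    (w2 : well_defined (tpar I2)) (h : coded_structure w1 -> coded_structure w2)
    (x : 'I_(dim (tcode I1)) -> B) (y : 'I_(dim (tcode I2)) -> B) : Prop :=
  exists (hx : in_dom (tpar I1) x) (hy : in_dom (tpar I2) y),
    h (class (exist _ x hx)) = class (exist _ y hy).

Definition homotopy I1 I2 (w1 : well_defined (tpar I1))
    (w2 : well_defined (tpar I2)) (h : coded_structure w1 -> coded_structure w2) :
    Prop :=
  isomorphism h /\
  exists (m1 : coded_structure w1 -> A) (m2 : coded_structure w2 -> A),
    [/\ induced_iso m1, induced_iso m2 & forall x, m1 x = m2 (h x)].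

Definition strongly_homotopic I1 I2 : Prop :=
  [/\ interpretation I1, interpretation I2 &
    exists (w1 : well_defined (tpar I1)) (w2 : well_defined (tpar I2))
      (h : coded_structure w1 -> coded_structure w2),
      homotopy h /\ definable (graph_preimage h)].

Definition absolutely_strongly_homotopic I1 I2 : Prop :=
  [/\ interpretation I1, interpretation I2,
      absolute_code (tcode I1), absolute_code (tcode I2) &
    exists (w1 : well_defined (tpar I1)) (w2 : well_defined (tpar I2))
      (h : coded_structure w1 -> coded_structure w2),
      homotopy h /\ absolutely_definable (graph_preimage h)].

(* The two coded structures have the same tuples, the same equivalence, and
   symbols coded by the same relations on the common domain; e only identifies
   the types of tuples of the same length. *)
Definition interpretation_eq I1 I2 : Prop :=
  exists e : dim (tcode I2) = dim (tcode I1),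
  let cast (x : 'I_(dim (tcode I1)) -> B) := fun i => x (cast_ord e i) in
  let D := in_dom (tpar I1) in
  [/\ forall x, D x <-> in_dom (tpar I2) (cast x),
      forall x y, D x -> D y ->
        sat (code_eq (tcode I1)) (code_val (pair_tup x y) (tpar I1)) <->
        sat (code_eq (tcode I2)) (code_val (pair_tup (cast x) (cast y)) (tpar I2)),
      [/\ forall c x, D x ->
            sat (code_cst (tcode I1) c) (code_val (fun=> x) (tpar I1)) <->
            sat (code_cst (tcode I2) c) (code_val (fun=> cast x) (tpar I2)),
          forall f xs, (forall i, D (xs i)) ->
            sat (code_fun (tcode I1) f) (code_val xs (tpar I1)) <->
            sat (code_fun (tcode I2) f) (code_val (fun i => cast (xs i)) (tpar I2)) &
          forall R xs, (forall i, D (xs i)) ->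
            sat (code_pred (tcode I1) R) (code_val xs (tpar I1)) <->
            sat (code_pred (tcode I2) R) (code_val (fun i => cast (xs i)) (tpar I2))] &
      forall x, D x -> tmap I1 x = tmap I2 (cast x)].

End Interpretations.

Definition id_interpretation L (A : structure L) : triple A A :=
  @Triple L L A A (id_code L) (nil_tup A) (fun x => x ord0).

Section Compositions.

Variables (LA LB LC : language).
Variables (A : structure LA) (B : structure LB) (C : structure LC).

(* pp, a tuple of tuples in flattened form, is a preimage of the parameters. *)
Definition par_preimage (I : triple A B) (J : triple B C)
    (pp : 'I_(pardim (tcode I) * dim (tcode J)) -> C) : Prop :=
  forall i, in_dom (tpar J) (block pp i) /\ tmap J (block pp i) = tpar I i.

Definition composition (I : triple A B) (J : triple B C)
    (pp : 'I_(pardim (tcode I) * dim (tcode J)) -> C) : triple A C :=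
  @Triple LA LC A C (comp_code (tcode I) (tcode J)) (cat_tup pp (tpar J))
    (fun x => tmap I (fun i => tmap J (block x i))).

End Compositions.

Arguments par_preimage {LA LB LC A B C} I J pp.
Arguments composition {LA LB LC A B C} I J pp.

Section Bi_interpretations.

Variables (LA LB : language) (A : structure LA) (B : structure LB).

Definition strong_bi_interpretation (I : triple A B) (J : triple B A) : Prop :=
  [/\ interpretation I, interpretation J,
      forall pp, par_preimage I J pp ->
        strongly_homotopic (composition I J pp) (id_interpretation A) &
      forall qq, par_preimage J I qq ->
        strongly_homotopic (composition J I qq) (id_interpretation B)].

Definition injective_triples (I : triple A B) (J : triple B A) : Prop :=
  injective_code (tcode I) /\ injective_code (tcode J).

Definition absolute_bi_interpretation (I : triple A B) (J : triple B A) : Prop :=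
  [/\ strong_bi_interpretation I J,
      absolute_code (tcode I), absolute_code (tcode J),
      forall pp, par_preimage I J pp ->
        absolutely_strongly_homotopic (composition I J pp) (id_interpretation A) &
      forall qq, par_preimage J I qq ->
        absolutely_strongly_homotopic (composition J I qq) (id_interpretation B)].

Definition strongly_bi_interpretable : Prop :=
  exists I J, strong_bi_interpretation I J.

Definition strongly_injectively_bi_interpretable : Prop :=
  exists I J, strong_bi_interpretation I J /\ injective_triples I J.

Definition strongly_absolutely_bi_interpretable : Prop :=
  exists I J, absolute_bi_interpretation I J.

Definition strongly_absolutely_injectively_bi_interpretable : Prop :=
  exists I J, absolute_bi_interpretation I J /\ injective_triples I J.

Definition syntactically_isomorphic : Prop :=
  exists (I : triple A B) (J : triple B A),
  [/\ strong_bi_interpretation I J,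
      forall pp, par_preimage I J pp ->
        interpretation_eq (composition I J pp) (id_interpretation A) &
      forall qq, par_preimage J I qq ->
        interpretation_eq (composition J I qq) (id_interpretation B)].

End Bi_interpretations.

(* Main.v *)
Require Import Defs.
From mathcomp Require Import all_boot matrix.
From mathcomp Require Import boolp.
From Stdlib Require Import RelationClasses.

Set Implicit Arguments.
Unset Strict Implicit.
Unset Printing Implicit Defensive.

(** Why the theorem holds.  Given bi-interpretations (I, J) of A and B and
    (I2, J2) of B and C, the pair (I o I2, J2 o J) is the required one.  What
    needs an argument is that the two homotopies to the identity are definable.
    A point x of the round trip (I o I2) o (J2 o J) in A codes, read halfway, one
    point u_i of I2 o J2 in B for each coordinate i of I.  The definable homotopy
    between I2 o J2 and the identity of B gives the relation saying that the
    value of u_i is b_i; pulled back along J it is definable in A, where b_i is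
    replaced by a J-code w_i.
    The definable homotopy between I o J and the identity of A gives the
    relation saying that the value of w is y.  Hence
       the value of x is y  iff  x is in the domain, and for some w,
       each w_i is a J-code of the value of u_i, and the value of w is y,
    which is a definable relation ([round_trip_graph], [defset_round_trip]).
    The round trip through C is the same statement with A and C exchanged.

    To work with this, quotient structures are eliminated at the outset: a
    triple is an interpretation exactly when its formulas, evaluated on tuples
    of the domain, hold of the images under the coordinate map
    ([interpretation_faithful], [faithful_interpretation]), and it is strongly
    homotopic to the identity exactly when its coordinate map has a definable
    graph ([strongly_homotopic_idE], [absolutely_strongly_homotopic_idE]).  The
    translation theorem ([sat_translate_nf], [sat_translate]) then shows that
    compositions are interpretations and that definability pulls back along
    interpretations ([defset_pullback]).

    Three refinements.  Absoluteness is followed by a flag that forbids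
    parameters in all the definability lemmas.  For injectivity, the code of a
    composition expresses equality of tuples on its domain, but by a translated
    formula, so its equality formula is replaced by the literal one, which leaves domain
    and coordinate map unchanged.  For syntactic isomorphism, being equal to the
    identical interpretation means that the dimension is 1, the domain is
    everything and the coordinate map is the only coordinate
    ([interpretation_eq_idE]); the formula for u_i above then computes the
    coordinate map of the round trip. *)

(** * Tuples of tuples *)

Definition unblock T n m (f : 'I_n -> 'I_m -> T) : 'I_(n * m) -> T :=
  fun k =>
    let ij := enum_val (cast_ord (esym (mxvec_cast n m)) k) in f ij.1 ij.2.

Lemma unblockE T n m (f : 'I_n -> 'I_m -> T) i j :
  unblock f (mxvec_index i j) = f i j.
Proof. by rewrite /unblock /mxvec_index cast_ordK enum_rankK. Qed.

Lemma block_unblock T n m (f : 'I_n -> 'I_m -> T) : block (unblock f) = f.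
Proof. by apply: funext => i; apply: funext => j; exact: unblockE. Qed.

Lemma block_inj T n m : injective (@block T n m).
Proof.
move=> x y e; apply: funext => k; case/mxvec_indexP: k => i j.
by have := congr1 (fun f => f i j) e.
Qed.

Lemma cat_tup_lshift T m n (x : 'I_m -> T) (y : 'I_n -> T) i :
  cat_tup x y (lshift n i) = x i.
Proof.
rewrite /cat_tup; case: split_ordP => j; first by move/lshift_inj ->.
by move/eqP; rewrite eq_lrshift.
Qed.

Lemma cat_tup_rshift T m n (x : 'I_m -> T) (y : 'I_n -> T) i :
  cat_tup x y (rshift m i) = y i.
Proof.
rewrite /cat_tup; case: split_ordP => j; last by move/rshift_inj ->.
by move/esym/eqP; rewrite eq_lrshift.
Qed.

Lemma pair_tup_map T U (f : T -> U) x y :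
  (fun i => f (pair_tup x y i)) = pair_tup (f x) (f y).
Proof. by apply: funext => i; rewrite /pair_tup /cons_tup; case: unliftP. Qed.

Lemma cons_tup_map T U (f : T -> U) n x (xs : 'I_n -> T) :
  (fun i => f (cons_tup x xs i)) = cons_tup (f x) (fun i => f (xs i)).
Proof. by apply: funext => i; rewrite /cons_tup; case: unliftP. Qed.

Lemma forall_cons_tup T (P : T -> Prop) n x (xs : 'I_n -> T) :
  (forall i, P (cons_tup x xs i)) <-> P x /\ forall i, P (xs i).
Proof.
split=> [H|[Hx H] i]; last by rewrite /cons_tup; case: unliftP.
split=> [|i]; first by have := H ord0; rewrite /cons_tup unlift_none.
by have := H (lift ord0 i); rewrite /cons_tup liftK.
Qed.

Definition tuple_val T V d k (w : V -> 'I_d -> T) (p : 'I_k -> T) :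
    V * 'I_d + 'I_k -> T :=
  fun z => match z with inl xj => w xj.1 xj.2 | inr l => p l end.

(** * Interpretations described by their coordinate maps *)

(** What an interpretation amounts to once classes are identified with their
    images under the coordinate map: no quotient and no choice of the
    isomorphism remains, so that compositions and translations can be treated
    by evaluating formulas. *)
Record faithful L K (A : structure L) (B : structure K) (I : triple A B) :
    Prop := Faithful {
  faithful_onto : forall a, exists2 b, in_dom (tpar I) b & tmap I b = a;
  faithful_eq : forall b b', in_dom (tpar I) b -> in_dom (tpar I) b' ->
    sat (code_eq (tcode I)) (code_val (pair_tup b b') (tpar I))
      <-> tmap I b = tmap I b';
  faithful_cst : forall c b, in_dom (tpar I) b ->
    sat (code_cst (tcode I) c) (code_val (fun=> b) (tpar I))
      <-> tmap I b = cst_in A c;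
  faithful_fun : forall f b0 bs, in_dom (tpar I) b0 ->
    (forall i, in_dom (tpar I) (bs i)) ->
    sat (code_fun (tcode I) f) (code_val (cons_tup b0 bs) (tpar I))
      <-> tmap I b0 = fun_in A f (fun i => tmap I (bs i));
  faithful_pred : forall R bs, (forall i, in_dom (tpar I) (bs i)) ->
    sat (code_pred (tcode I) R) (code_val bs (tpar I))
      <-> pred_in A R (fun i => tmap I (bs i)) }.

Lemma class_eqP L K (G : code L K) (B : structure K) (p : 'I_(pardim G) -> B)
    (w : well_defined p) (b b' : dom p) :
  class b = class b' <-> code_rel b b'.
Proof.
have [r s t] := wd_equiv w; split=> [[e]|H].
  by rewrite e; exact: r.
apply: eq_exist => /=; apply: funext => c; apply: propext; split.
  by apply: t; exact: s.
exact: t.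
Qed.

Lemma class_surj L K (G : code L K) (B : structure K) (p : 'I_(pardim G) -> B)
    (q : quotient p) : exists b, class b = q.
Proof. by case: q => S [b e]; exists b; apply: eq_exist. Qed.

Lemma interpretation_faithful L K (A : structure L) (B : structure K)
    (I : triple A B) : interpretation I -> faithful I.
Proof.
move=> [onto [w [m [[mbij mc mf mR] mE]]]].
have minj := bij_inj mbij.
have E (b b' : dom (tpar I)) :
    class b = class b' <-> tmap I (sval b) = tmap I (sval b').
  by rewrite -!mE; split=> [-> //|]; exact: minj.
split.
- by move=> a; have [[b Hb] <-] := onto a; exists b.
- move=> b b' Hb Hb'; have := E (exist _ b Hb) (exist _ b' Hb').
  by rewrite (class_eqP w).
- move=> c b Hb; have := svalP (cid (wd_cst w c)) (exist _ b Hb) => /= ->.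
  rewrite -mc -[in X in _ <-> X](mE (exist _ b Hb)).
  by split=> [-> //|]; exact: minj.
- move=> f b0 bs Hb0 Hbs.
  have := svalP (cid (wd_fun w f)) (exist _ b0 Hb0)
    (fun i => exist _ (bs i) (Hbs i)) => /= ->.
  rewrite -[in X in _ <-> X](mE (exist _ b0 Hb0)).
  have -> : (fun i => tmap I (bs i)) =
      (fun i => m (class (exist _ (bs i) (Hbs i)))).
    by apply: funext => i; rewrite mE.
  by rewrite -mf; split=> [-> //|]; exact: minj.
- move=> R bs Hbs.
  have := svalP (cid (wd_pred w R)) (fun i => exist _ (bs i) (Hbs i)) => /= ->.
  have -> : (fun i => tmap I (bs i)) =
      (fun i => m (class (exist _ (bs i) (Hbs i)))).
    by apply: funext => i; rewrite mE.
  by rewrite -mR.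
Qed.

Lemma inj_surj_bijective T U (f : T -> U) :
  injective f -> (forall y, exists x, f x = y) -> bijective f.
Proof.
move=> fi fs; exists (fun y => sval (cid (fs y))) => [x|y].
  by apply: fi; exact: (svalP (cid (fs (f x)))).
exact: (svalP (cid (fs y))).
Qed.

(** The equality clause says that the coordinate map descends to an injection of
    the quotient, so every value prescribed in A determines one class; this
    supplies the constants, operations and relations of the coded structure. *)
Lemma faithful_interpretation L K (A : structure L) (B : structure K)
    (I : triple A B) : faithful I -> interpretation I.
Proof.
case=> onto HE Hc Hf HR.
have onto' a : exists b : dom (tpar I), tmap I (sval b) = a.
  by have [b Hb <-] := onto a; exists (exist _ b Hb).
split; first exact: onto'.
have relE (b b' : dom (tpar I)) :
    code_rel b b' <-> tmap I (sval b) = tmap I (sval b').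
  by apply: HE; exact: svalP.
have Heq : Equivalence (@code_rel _ _ _ _ (tpar I)).
  split=> [b|b b'|b b' b'']; rewrite !relE //.
  by move=> ->.
have E (b b' : dom (tpar I)) :
    class b = class b' <-> tmap I (sval b) = tmap I (sval b').
  rewrite -relE; split=> [[->]|H]; first by rewrite relE.
  apply: eq_exist => /=; apply: funext => c; apply: propext.
  by move: H; rewrite !relE => ->.
pose m (q : quotient (tpar I)) : A := tmap I (sval (sval (cid (class_surj q)))).
have mE b : m (class b) = tmap I (sval b).
  by apply/E; exact: (svalP (cid (class_surj (class b)))).
have minj : injective m.
  move=> q q'; have [b <-] := class_surj q; have [b' <-] := class_surj q'.
  by rewrite !mE => /E.
have msurj a : exists q, m q = a.
  by have [b <-] := onto' a; exists (class b); rewrite mE.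
have w : well_defined (tpar I).
  split=> //.
  - by have [a] := carrier_nonempty A; have [b _] := onto' a; exists.
  - move=> c; have [q e] := msurj (cst_in A c); exists q => b.
    rewrite (Hc c (sval b) (svalP b)) -e -mE.
    by split=> [|-> //]; exact: minj.
  - move=> f.
    exists (fun qs => sval (cid (msurj (fun_in A f (fun i => m (qs i)))))).
    move=> b0 bs.
    rewrite (Hf f _ _ (svalP b0) (fun i => svalP (bs i))) -mE.
    case: cid => q /= e.
    have -> : (fun i => tmap I (sval (bs i))) = (fun i => m (class (bs i))).
      by apply: funext => i; rewrite mE.
    by rewrite -e; split=> [|-> //]; exact: minj.
  - move=> R; exists (fun qs => pred_in A R (fun i => m (qs i))) => bs.
    rewrite (HR R _ (fun i => svalP (bs i))).
    suff -> : (fun i => tmap I (sval (bs i))) = (fun i => m (class (bs i)))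
      by [].
    by apply: funext => i; rewrite mE.
have repr n (qs : 'I_n -> quotient (tpar I)) :
    exists bs : 'I_n -> dom (tpar I), qs = (fun i => class (bs i)).
  exists (fun i => sval (cid (class_surj (qs i)))).
  by apply: funext => i; case: cid.
exists w, m; split=> //; split.
- exact: inj_surj_bijective.
- move=> c /=; case: cid => q /= Hq.
  have [b e] := class_surj q.
  by rewrite -e mE; apply/(Hc c (sval b) (svalP b)); apply/Hq.
- move=> f qs /=; case: cid => g /= Hg.
  have [bs ->] := repr _ qs.
  have [b e] := class_surj (g (fun i => class (bs i))).
  have /Hg := esym (esym e); rewrite -e mE.
  rewrite (Hf f _ _ (svalP b) (fun i => svalP (bs i))) => ->.
  by congr fun_in; apply: funext => i; rewrite mE.
- move=> R qs /=; case: cid => r /= Hr.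
  have [bs ->] := repr _ qs.
  rewrite -Hr (HR R _ (fun i => svalP (bs i))).
  suff -> : (fun i => tmap I (sval (bs i))) = (fun i => m (class (bs i))) by [].
  by apply: funext => i; rewrite mE.
Qed.

(** * The translation theorem *)

Section TranslationTheorem.

Variables (L K : language) (A : structure L) (B : structure K) (I : triple A B).
Hypothesis HI : faithful I.

Let val V (w : V -> 'I_(dim (tcode I)) -> B) := tuple_val w (tpar I).

Lemma sat_place r V
    (phi : formula K (code_vars (dim (tcode I)) (pardim (tcode I)) r))
    (xs : 'I_r -> V) (w : V -> 'I_(dim (tcode I)) -> B) :
  sat (rename (place (G := tcode I) xs) phi) (val w) <->
  sat phi (code_val (fun i => w (xs i)) (tpar I)).
Proof.
by rewrite sat_rename; suff -> : val w \o place xs =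
  code_val (fun i => w (xs i)) (tpar I) by []; apply: funext => -[].
Qed.

Lemma sat_dom_at V (x : V) w :
  sat (dom_at (tcode I) x) (val w) <-> in_dom (tpar I) (w x).
Proof. exact: sat_place. Qed.

Lemma sat_translate_unnested V (a : unnested L V) w :
  (forall x, in_dom (tpar I) (w x)) ->
  sat (translate_unnested (tcode I) a) (val w) <->
  sat (unnested_formula a) (tmap I \o w).
Proof.
move=> Hw; case: a => [x y|x c|f xs x0|R xs] /=; rewrite sat_place.
- by rewrite (pair_tup_map w) (faithful_eq HI).
- by rewrite (faithful_cst HI).
- rewrite (cons_tup_map w) (faithful_fun HI) //.
  by split=> ->.
- by rewrite (faithful_pred HI).
Qed.

(** The variable type V is arbitrary here, so that it may include a copy of the
    structure serving as parameters; the hypothesis on w stands for the domain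
    conjuncts, which only make sense for finitely many variables. *)
Lemma sat_translate_nf V (n : normal_form L V) w :
  (forall x, in_dom (tpar I) (w x)) ->
  sat (translate_nf (tcode I) n) (val w) <-> sat (nf_formula n) (tmap I \o w).
Proof.
have exposeE U (phi : formula K (option U * _ + _)) u b :
    sat (rename (@expose _ _ _ U) phi) (val_sum (val u) b) <->
    sat phi (val (push u b)).
  rewrite sat_rename; suff -> : val_sum (val u) b \o @expose _ _ _ U =
    val (push u b) by [].
  by apply: funext => -[[[x|] j]|l].
have pushE U (u : U -> _) b :
    tmap I \o push u b = push (tmap I \o u) (tmap I b).
  by apply: funext => -[].
have pushD U (u : U -> _) b : (forall x, in_dom (tpar I) (u x)) ->
    in_dom (tpar I) b -> forall x, in_dom (tpar I) (push u b x).
  by move=> ? ? [].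
elim: n w => {}V.
- elim=> [c|d1 IH1 d2 IH2] w Hw /=; last by rewrite IH1 // IH2.
  elim: c => [a|a|c1 IH1 c2 IH2] /=; last by rewrite IH1 IH2.
  + exact: sat_translate_unnested.
  + by rewrite sat_translate_unnested.
- move=> n IH w Hw /=; rewrite sat_alls; split=> H.
    move=> a; have [b Hb <-] := faithful_onto HI a.
    rewrite -pushE -IH; last exact: pushD.
    have := H b; rewrite /= 2!exposeE sat_dom_at; exact.
  move=> b; rewrite /= 2!exposeE sat_dom_at /= => Hb.
  by rewrite IH ?pushE //; exact: pushD.
- move=> n IH w Hw /=; rewrite sat_exs; split=> -[].
    move=> b; rewrite /= 2!exposeE sat_dom_at /= => -[Hb].
    by rewrite IH ?pushE; [exists (tmap I b) | exact: pushD].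
  move=> a; have [b Hb <-] := faithful_onto HI a => H; exists b.
  rewrite /= 2!exposeE sat_dom_at /=; split=> //.
  by rewrite IH ?pushE //; exact: pushD.
Qed.
End TranslationTheorem.

Lemma sat_foldr_enum L (M : structure L) (V : Type) (v : V -> M) (X : finType)
    (phi : X -> formula L V) (P : Prop) :
  foldr (fun psi Q => sat psi v /\ Q) P [seq phi x | x <- enum X] <->
  (forall x, sat (phi x) v) /\ P.
Proof.
have H (s : seq X) :
    foldr (fun psi Q => sat psi v /\ Q) P [seq phi x | x <- s] <->
    (forall x, x \in s -> sat (phi x) v) /\ P.
  elim: s => [|x s IH] /=; first by split=> // -[].
  rewrite IH; split=> [[Hx [H HP]]|[H HP]].
    by split=> // y; rewrite in_cons => /orP[/eqP -> //|]; exact: H.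
  split; first by apply: H; rewrite mem_head.
  by split=> // y Hy; apply: H; rewrite in_cons Hy orbT.
rewrite H; split=> -[H' HP]; split=> // x.
by apply: H'; rewrite mem_enum.
Qed.

Lemma sat_to_nf L (M : structure L) V (phi : formula L V) (v : V -> M) :
  sat (nf_formula (to_nf phi)) v <-> sat phi v.
Proof. by rewrite /to_nf; case: cid => n [e _] /=; exact: e. Qed.

Lemma sat_translate L K (A : structure L) (B : structure K) (I : triple A B)
    (V : finType) (phi : formula L V) (w : V -> 'I_(dim (tcode I)) -> B) :
  faithful I ->
  sat (translate (tcode I) phi) (tuple_val w (tpar I)) <->
  (forall x, in_dom (tpar I) (w x)) /\ sat phi (tmap I \o w).
Proof.
move=> HI; rewrite sat_conjunction foldr_rcons sat_foldr_enum.
split=> [[Hw [H _]]|[Hw H]].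
  have {}Hw x : in_dom (tpar I) (w x) by apply/sat_dom_at; exact: Hw.
  by split=> //; rewrite -sat_to_nf -sat_translate_nf.
split=> [x|]; first by apply/sat_dom_at.
by split=> //; rewrite sat_translate_nf // sat_to_nf.
Qed.

Lemma sat_tuple_eq K (B : structure K) d k (x y : 'I_d -> B) (p : 'I_k -> B) :
  sat (tuple_eq K d k) (code_val (pair_tup x y) p) <-> x = y.
Proof.
rewrite sat_conjunction sat_foldr_enum /=.
have e0 : pair_tup x y ord0 = x by rewrite /pair_tup /cons_tup unlift_none.
have e1 : pair_tup x y ord_max = y.
  by rewrite /pair_tup /cons_tup; case: unliftP.
rewrite e0 e1; split=> [[H _]|-> //].
by apply: funext.
Qed.

(** * Composition of interpretations *)

(** The equality formula E is left free because a composition of injective codes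
    has a translated formula where an injective code needs the literal equality
    of tuples. *)
Definition composition_with LA LB LC (A : structure LA) (B : structure LB)
    (C : structure LC) (I : triple A B) (J : triple B C) pp
    (E : formula LC (code_vars (dim (tcode I) * dim (tcode J))
           (pardim (tcode I) * dim (tcode J) + pardim (tcode J)) 2)) :
    triple A C :=
  @Triple LA LC A C
    (let G := comp_code (tcode I) (tcode J) in
     @Code LA LC (dim G) (pardim G) (code_dom G) E
       (code_cst G) (@code_fun _ _ G) (@code_pred _ _ G))
    (cat_tup pp (tpar J)) (tmap (composition I J pp)).

Arguments composition_with {LA LB LC A B C} I J pp E.

Section Composition.

Variables (LA LB LC : language).
Variables (A : structure LA) (B : structure LB) (C : structure LC).
Variables (I : triple A B) (J : triple B C).
Variable pp : 'I_(pardim (tcode I) * dim (tcode J)) -> C.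
Hypotheses (HI : faithful I) (HJ : faithful J) (Hpp : par_preimage I J pp).

Definition block_map (x : 'I_(dim (tcode I) * dim (tcode J)) -> C) :
    'I_(dim (tcode I)) -> B := fun i => tmap J (block x i).

(** [sat_translate], where the parameters of I occur among the variables and
    evaluate correctly because pp is a preimage of them. *)
Lemma sat_comp_formula r
    (phi : formula LB (code_vars (dim (tcode I)) (pardim (tcode I)) r))
    (xs : 'I_r -> 'I_(dim (tcode I) * dim (tcode J)) -> C) :
  sat (comp_formula (tcode J) phi) (code_val xs (cat_tup pp (tpar J))) <->
  (forall i j, in_dom (tpar J) (block (xs i) j)) /\
  sat phi (code_val (fun i => block_map (xs i)) (tpar I)).
Proof.
pose w (z : code_vars (dim (tcode I)) (pardim (tcode I)) r) :=
  match z with inl ij => block (xs ij.1) ij.2 | inr l => block pp l end.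
have valE : code_val xs (cat_tup pp (tpar J)) \o
    @comp_var _ _ _ (tcode I) (tcode J) r = tuple_val w (tpar J).
  apply: funext => -[[[[i j]|l] j']|l] //=.
    by rewrite cat_tup_lshift.
  by rewrite cat_tup_rshift.
have -> : code_val (fun i => block_map (xs i)) (tpar I) = tmap J \o w.
  by apply: funext => -[[i j]|l] //=; rewrite (proj2 (Hpp l)).
rewrite sat_rename valE sat_translate //.
split=> -[Hw H]; split=> //; first by move=> i j; exact: (Hw (inl (i, j))).
case=> [[i j]|l] /=; first exact: Hw.
exact: (proj1 (Hpp l)).
Qed.

Variable E : formula LC (code_vars (dim (tcode I) * dim (tcode J))
           (pardim (tcode I) * dim (tcode J) + pardim (tcode J)) 2).
Local Notation IJ := (composition_with I J pp E).

Lemma in_dom_composition_with (x : 'I_(dim (tcode I) * dim (tcode J)) -> C) :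
  in_dom (tpar IJ) x <->
  (forall i, in_dom (tpar J) (block x i)) /\ in_dom (tpar I) (block_map x).
Proof.
rewrite /in_dom (sat_comp_formula (code_dom _) (fun=> x)).
by split=> -[H H']; split=> // i; exact: H ord0 _.
Qed.

Lemma block_map_onto (b : 'I_(dim (tcode I)) -> B) :
  exists2 x, (forall i, in_dom (tpar J) (block x i)) & block_map x = b.
Proof.
have H i := cid2 (faithful_onto HJ (b i)).
exists (unblock (fun i => s2val (H i))) => [i|]; rewrite ?block_unblock.
  exact: (s2valP (H i)).
apply: funext => i; rewrite /block_map block_unblock.
exact: (s2valP' (H i)).
Qed.

Lemma composition_with_faithful :
  (forall x y, in_dom (tpar IJ) x -> in_dom (tpar IJ) y ->
    sat E (code_val (pair_tup x y) (tpar IJ)) <-> tmap IJ x = tmap IJ y) ->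
  faithful IJ.
Proof.
move=> HE; split=> //.
- move=> a; have [b Hb <-] := faithful_onto HI a.
  have [x Hx e] := block_map_onto b; exists x; last by rewrite /= -e.
  by rewrite in_dom_composition_with e.
- move=> c x /in_dom_composition_with[Hx H].
  rewrite sat_comp_formula (faithful_cst HI) //.
  by split=> [[]|].
- move=> f x0 xs /in_dom_composition_with[H0 H0'] Hxs.
  have {}Hxs i := proj1 (in_dom_composition_with _) (Hxs i).
  rewrite sat_comp_formula (cons_tup_map block_map) (faithful_fun HI) //;
    last first.
    by move=> i; have [] := Hxs i.
  split=> [[]|] //; split=> //.
  apply/(forall_cons_tup (fun x => forall j, in_dom (tpar J) (block x j))).
  by split=> // i; have [] := Hxs i.
- move=> R xs Hxs; have {}Hxs i := proj1 (in_dom_composition_with _) (Hxs i).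
  rewrite sat_comp_formula (faithful_pred HI) //; last first.
    by move=> i; have [] := Hxs i.
  by split=> [[]|] //; split=> // i; have [] := Hxs i.
Qed.

End Composition.

Lemma in_dom_composition LA LB LC (A : structure LA) (B : structure LB)
    (C : structure LC) (I : triple A B) (J : triple B C) pp x :
  faithful J -> par_preimage I J pp ->
  in_dom (tpar (composition I J pp)) x <->
  (forall i, in_dom (tpar J) (block x i)) /\
  in_dom (tpar I) (block_map (J := J) x).
Proof.
move=> HJ Hpp.
exact: (in_dom_composition_with HJ Hpp (code_eq (comp_code _ _)) x).
Qed.

Lemma composition_faithful LA LB LC (A : structure LA) (B : structure LB)
    (C : structure LC) (I : triple A B) (J : triple B C) pp :
  faithful I -> faithful J -> par_preimage I J pp ->
  faithful (composition I J pp).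
Proof.
move=> HI HJ Hpp.
pose E := code_eq (comp_code (tcode I) (tcode J)).
apply: (composition_with_faithful HI HJ Hpp (E := E)).
move=> x y /(in_dom_composition_with HJ Hpp)[Hx Hx'].
move=> /(in_dom_composition_with HJ Hpp)[Hy Hy'].
rewrite sat_comp_formula // (pair_tup_map (block_map (J := J))).
rewrite (faithful_eq HI) //.
split=> [[]|] //; split=> //.
apply/(forall_cons_tup (fun x => forall j, in_dom (tpar J) (block x j))).
by split.
Qed.

Lemma par_preimage_exists LA LB LC (A : structure LA) (B : structure LB)
    (C : structure LC) (I : triple A B) (J : triple B C) :
  faithful J -> exists pp, par_preimage I J pp.
Proof.
move=> HJ; have H i := cid2 (faithful_onto HJ (tpar I i)).
exists (unblock (fun i => s2val (H i))) => i; rewrite block_unblock.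
by split; [exact: (s2valP (H i)) | exact: (s2valP' (H i))].
Qed.

Lemma tmap_injective L K (A : structure L) (B : structure K) (I : triple A B) :
  faithful I -> injective_code (tcode I) ->
  forall x y, in_dom (tpar I) x -> in_dom (tpar I) y ->
  tmap I x = tmap I y -> x = y.
Proof.
by move=> HI e x y Hx Hy /(faithful_eq HI Hx Hy); rewrite e sat_tuple_eq.
Qed.

(** Both coordinate maps are injective on their domains, hence so is the
    composite one, and literal equality is the right equality formula. *)
Lemma composition_with_tuple_eq_faithful LA LB LC (A : structure LA)
    (B : structure LB) (C : structure LC) (I : triple A B) (J : triple B C) pp :
  faithful I -> faithful J -> par_preimage I J pp ->
  injective_code (tcode I) -> injective_code (tcode J) ->
  faithful (composition_with I J pp (tuple_eq LC _ _)).
Proof.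
move=> HI HJ Hpp iI iJ; apply: composition_with_faithful => //.
move=> x y /(in_dom_composition_with HJ Hpp)[Hx Hx'].
move=> /(in_dom_composition_with HJ Hpp)[Hy Hy'].
rewrite sat_tuple_eq; split=> [-> //|].
move/(tmap_injective HI iI Hx' Hy') => e.
apply: block_inj; apply: funext => i; apply: (tmap_injective HJ iJ) => //.
by have := congr1 (fun f => f i) e.
Qed.

(** * Definable sets *)

Definition sum_val T V P (v : V -> T) (e : P -> T) : V + P -> T :=
  fun x => match x with inl y => v y | inr c => e c end.

(** Definability of a set of valuations.  The parameters are the values e of an
    additional supply P of variables rather than constants of an extended
    language: they can then be translated and renamed like variables.  When abs
    is true, P is empty, which is definability without parameters; treating
    both cases at once avoids proving the closure properties twice. *)
Definition defset (abs : bool) L (M : structure L) V (Q : (V -> M) -> Prop) :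
    Prop :=
  exists (P : Type) (e : P -> M) (psi : formula L (V + P)),
  (abs -> P -> False) /\ forall v, sat psi (sum_val v e) <-> Q v.

Section DefinableSets.

Variables (abs : bool) (L : language) (M : structure L).

Lemma defset_ext V (Q Q' : (V -> M) -> Prop) :
  (forall v, Q v <-> Q' v) -> defset abs Q -> defset abs Q'.
Proof.
by move=> QQ' [P [e [psi [HP H]]]]; exists P, e, psi; split=> // v; rewrite H.
Qed.

Lemma defset_rename V W (h : V -> W) (Q : (V -> M) -> Prop) :
  defset abs Q -> defset abs (fun w => Q (w \o h)).
Proof.
move=> [P [e [psi [HP H]]]].
pose k (x : V + P) : W + P :=
  match x with inl y => inl (h y) | inr c => inr c end.
exists P, e, (rename k psi); split=> // v; rewrite sat_rename -H.
suff -> : sum_val v e \o k = sum_val (v \o h) e by [].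
by apply: funext => -[].
Qed.

Lemma defset_true V : defset abs (fun _ : V -> M => True).
Proof.
by exists void, (fun c : void => match c with end), Top; split=> // _ [].
Qed.

Lemma defset_and V (Q Q' : (V -> M) -> Prop) :
  defset abs Q -> defset abs Q' -> defset abs (fun v => Q v /\ Q' v).
Proof.
move=> [P [e [psi [HP H]]]] [P' [e' [psi' [HP' H']]]].
pose l (x : V + P) : V + (P + P') :=
  match x with inl y => inl y | inr c => inr (inl c) end.
pose r (x : V + P') : V + (P + P') :=
  match x with inl y => inl y | inr c => inr (inr c) end.
exists (P + P')%type, (sum_val e e'), (And (rename l psi) (rename r psi')).
split=> [a [/(HP a)|/(HP' a)] //|v] /=; rewrite !sat_rename -H -H'.
have -> : sum_val v (sum_val e e') \o l = sum_val v e by apply: funext => -[].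
suff -> : sum_val v (sum_val e e') \o r = sum_val v e' by [].
by apply: funext => -[].
Qed.

Lemma defset_exists m V (Q : (V + 'I_m -> M) -> Prop) :
  defset abs Q -> defset abs (fun v => exists b, Q (val_sum v b)).
Proof.
move=> [P [e [psi [HP H]]]].
pose h (x : V + 'I_m + P) := match x with
  | inl (inl y) => inl (inl y)
  | inl (inr i) => inr i
  | inr c => inl (inr c)
  end.
exists P, e, (exs (rename h psi)); split=> // v; rewrite sat_exs.
have E b : sat (rename h psi) (val_sum (sum_val v e) b) <-> Q (val_sum v b).
  rewrite sat_rename -H.
  suff -> : val_sum (sum_val v e) b \o h = sum_val (val_sum v b) e by [].
  by apply: funext => -[[]|].
by split=> -[b /E Hb]; exists b.
Qed.

Lemma defset_forall (X : finType) V (Q : X -> (V -> M) -> Prop) :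
  (forall x, defset abs (Q x)) -> defset abs (fun v => forall x, Q x v).
Proof.
move=> H.
have {}H (s : seq X) : defset abs (fun v => forall x, x \in s -> Q x v).
  elim: s => [|x s IH]; first by apply: defset_ext (defset_true V).
  apply: defset_ext (defset_and (H x) IH) => v; split=> [[Hx Hs] y|Hs].
    by rewrite in_cons => /orP[/eqP ->|/Hs].
  by split=> [|y Hy]; apply: Hs; rewrite in_cons ?eqxx // Hy orbT.
apply: defset_ext (H (enum X)) => v; split=> Hv x; last by move=> _; exact: Hv.
by apply: Hv; rewrite mem_enum.
Qed.

End DefinableSets.

(** * Definability along an interpretation *)

Lemma defset_in_dom (abs : bool) L K (A : structure L) (B : structure K)
    (I : triple A B) :
  (abs -> pardim (tcode I) = 0) -> defset abs (in_dom (tpar I)).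
Proof.
move=> Habs.
pose h (z : code_vars (dim (tcode I)) (pardim (tcode I)) 1) :=
  match z with inl ij => inl ij.2 | inr l => inr l end.
exists 'I_(pardim (tcode I)), (tpar I), (rename h (code_dom (tcode I))).
split=> [a|v]; first by rewrite Habs // => -[].
rewrite sat_rename /in_dom.
suff -> : sum_val v (tpar I) \o h = code_val (fun=> v) (tpar I) by [].
by apply: funext => -[].
Qed.

(** The formula defining Q is translated, each of its parameters being replaced
    by a tuple that codes it.  The new parameters are the entries of these
    tuples and the parameters of I; there are none if Q has no parameters and I
    is absolute. *)
Lemma defset_pullback (abs : bool) L K (A : structure L) (B : structure K)
    (I : triple A B) (V : finType) (Q : (V -> A) -> Prop) :
  faithful I -> (abs -> pardim (tcode I) = 0) -> defset abs Q ->
  defset abs (fun w : V * 'I_(dim (tcode I)) -> B =>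
    (forall x, in_dom (tpar I) (fun j => w (x, j))) /\
    Q (fun x => tmap I (fun j => w (x, j)))).
Proof.
move=> HI Habs [P [e [psi [HP H]]]].
have Hdom : defset abs (fun w : V * 'I_(dim (tcode I)) -> B =>
    forall x, in_dom (tpar I) (fun j => w (x, j))).
  apply: defset_forall => x.
  exact: (defset_rename (pair x) (defset_in_dom Habs)).
have He c := cid2 (faithful_onto HI (e c)).
pose e' c := s2val (He c).
pose d := dim (tcode I); pose k := pardim (tcode I).
have : defset abs (fun w : V * 'I_d -> B =>
    sat (translate_nf (tcode I) (to_nf psi))
      (tuple_val (sum_val (fun x j => w (x, j)) e') (tpar I))).
  pose h (z : (V + P) * 'I_d + 'I_k) : V * 'I_d + (P * 'I_d + 'I_k) :=
    match z with
    | inl (inl x, j) => inl (x, j)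
    | inl (inr c, j) => inr (inl (c, j))
    | inr l => inr (inr l)
    end.
  exists (P * 'I_d + 'I_k)%type, (tuple_val e' (tpar I)).
  exists (rename h (translate_nf (tcode I) (to_nf psi))).
  split=> [a [[c _]|]|w]; first exact: HP a c.
    by rewrite /k Habs // => -[].
  rewrite sat_rename.
  suff -> : sum_val w (tuple_val e' (tpar I)) \o h =
    tuple_val (sum_val (fun x j => w (x, j)) e') (tpar I) by [].
  by apply: funext => -[[[x|c] j]|l].
move=> /(defset_and Hdom); apply: defset_ext => w.
suff E : (forall x, in_dom (tpar I) (fun j => w (x, j))) ->
    sat (translate_nf (tcode I) (to_nf psi))
      (tuple_val (sum_val (fun x j => w (x, j)) e') (tpar I)) <->
    Q (fun x => tmap I (fun j => w (x, j))).
  by split=> -[Hw HQ]; split=> //; apply/(E Hw).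
move=> Hw; rewrite sat_translate_nf //; last first.
  by case=> // c; exact: (s2valP (He c)).
rewrite sat_to_nf -H.
suff -> : tmap I \o sum_val (fun x j => w (x, j)) e' =
  sum_val (fun x => tmap I (fun j => w (x, j))) e by [].
by apply: funext => -[x|c] //=; exact: (s2valP' (He c)).
Qed.

(** * Constants as parameters *)

Section Naming.

Variables (K : language) (B : structure K).

Local Notation KB := (language_with K B).

(** The map h decides which variables stay variables and which become names of
    elements. *)
Fixpoint name_term (V W : Type) (h : V -> W + B) (t : term K V) : term KB W :=
  match t with
  | Var x => match h x with inl y => Var y | inr b => @Cst KB W (inr b) end
  | Cst c => @Cst KB W (inl c)
  | App f ts => @App KB W f (fun i => name_term h (ts i))
  end.

Definition name_lift (V W : Type) (h : V -> W + B) (x : option V) :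
    option W + B :=
  match x with
  | Some y => match h y with inl z => inl (Some z) | inr b => inr b end
  | None => inl None
  end.

Fixpoint name_elements (V W : Type) (h : V -> W + B) (phi : formula K V) :
    formula KB W :=
  match phi with
  | Top => Top
  | Eq t u => Eq (name_term h t) (name_term h u)
  | Pred R ts => @Pred KB W R (fun i => name_term h (ts i))
  | Not p => Not (name_elements h p)
  | And p q => And (name_elements h p) (name_elements h q)
  | Or p q => Or (name_elements h p) (name_elements h q)
  | Imp p q => Imp (name_elements h p) (name_elements h q)
  | All p => All (name_elements (name_lift h) p)
  | Ex p => Ex (name_elements (name_lift h) p)
  end.

(** The inverse passage: the name of b becomes the variable g b, which is only
    meaningful for valuations v with v \o g = id. *)
Fixpoint unname_term (V W : Type) (h : V -> W) (g : B -> W) (t : term KB V) :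
    term K W :=
  match t with
  | Var x => Var (h x)
  | Cst c => match c with inl c' => Cst c' | inr b => Var (g b) end
  | App f ts => @App K W f (fun i => unname_term h g (ts i))
  end.

Fixpoint unname_elements (V W : Type) (h : V -> W) (g : B -> W)
    (phi : formula KB V) : formula K W :=
  match phi with
  | Top => Top
  | Eq t u => Eq (unname_term h g t) (unname_term h g u)
  | Pred R ts => @Pred K W R (fun i => unname_term h g (ts i))
  | Not p => Not (unname_elements h g p)
  | And p q => And (unname_elements h g p) (unname_elements h g q)
  | Or p q => Or (unname_elements h g p) (unname_elements h g q)
  | Imp p q => Imp (unname_elements h g p) (unname_elements h g q)
  | All p => All (unname_elements (omap h) (Some \o g) p)
  | Ex p => Ex (unname_elements (omap h) (Some \o g) p)
  end.

Lemma eval_name_term (V W : Type) (h : V -> W + B) (t : term K V) (v : W -> B) :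
  eval (M := structure_with B) v (name_term h t) = eval (sum_val v id \o h) t.
Proof.
elim: t => //= [x|f ts IH]; first by case: (h x).
by congr fun_in; apply: funext.
Qed.

Lemma sat_name_elements (V W : Type) (h : V -> W + B) (phi : formula K V)
    (v : W -> B) :
  sat (M := structure_with B) (name_elements h phi) v <->
  sat phi (sum_val v id \o h).
Proof.
have lift U X (k : U -> X + B) (u : X -> B) a :
    sum_val (push u a) id \o name_lift k = push (sum_val u id \o k) a.
  by apply: funext => -[x|] //=; case: (k x).
elim: phi W h v => //=.
- by move=> ? t u W h v; rewrite !eval_name_term.
- move=> ? R ts W h v.
  suff -> : (fun i => eval (M := structure_with B) v (name_term h (ts i))) =
    (fun i => eval (sum_val v id \o h) (ts i)) by [].
  by apply: funext => i; rewrite eval_name_term.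
- by move=> ? p IH W h v; rewrite IH.
- by move=> ? p IHp q IHq W h v; rewrite IHp IHq.
- by move=> ? p IHp q IHq W h v; rewrite IHp IHq.
- by move=> ? p IHp q IHq W h v; rewrite IHp IHq.
- by move=> ? p IH W h v; split=> H a; have := H a; rewrite IH lift.
- by move=> ? p IH W h v; split=> -[a H]; exists a; move: H; rewrite IH lift.
Qed.

Lemma eval_unname_term (V W : Type) (h : V -> W) (g : B -> W) (t : term KB V)
    (v : W -> B) :
  v \o g = id ->
  eval v (unname_term h g t) = eval (M := structure_with B) (v \o h) t.
Proof.
move=> vg; elim: t => //= [[c|b]|f ts IH] //; first exact: (congr1 (@^~ b) vg).
by congr (fun_in B); apply: funext.
Qed.

Lemma sat_unname_elements (V W : Type) (h : V -> W) (g : B -> W)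
    (phi : formula KB V) (v : W -> B) :
  v \o g = id ->
  sat (unname_elements h g phi) v <-> sat (M := structure_with B) phi (v \o h).
Proof.
elim: phi W h g v => //=.
- by move=> ? t u W h g v vg; rewrite !eval_unname_term.
- move=> ? R ts W h g v vg.
  suff -> : (fun i => eval v (unname_term h g (ts i))) =
    (fun i => eval (M := structure_with B) (v \o h) (ts i)) by [].
  by apply: funext => i; rewrite eval_unname_term.
- by move=> ? p IH W h g v vg; rewrite IH.
- by move=> ? p IHp q IHq W h g v vg; rewrite IHp // IHq.
- by move=> ? p IHp q IHq W h g v vg; rewrite IHp // IHq.
- by move=> ? p IHp q IHq W h g v vg; rewrite IHp // IHq.
- move=> ? p IH W h g v vg.
  by split=> H a; have := H a; rewrite IH // push_omap.
- move=> ? p IH W h g v vg.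
  by split=> -[a H]; exists a; move: H; rewrite IH // push_omap.
Qed.

Lemma val_sumK T m n (v : 'I_m + 'I_n -> T) :
  val_sum (fun i => v (inl i)) (fun j => v (inr j)) = v.
Proof. by apply: funext => -[]. Qed.

Lemma definableE m n (Q : ('I_m -> B) -> ('I_n -> B) -> Prop) :
  definable Q <->
  defset false (fun v : 'I_m + 'I_n -> B =>
    Q (fun i => v (inl i)) (fun j => v (inr j))).
Proof.
split=> [[phi H]|[P [e [psi [_ H]]]]].
  exists B, id, (unname_elements inl inr phi); split=> // v.
  by rewrite sat_unname_elements // -H val_sumK.
pose h (x : 'I_m + 'I_n + P) : 'I_m + 'I_n + B :=
  match x with inl y => inl y | inr c => inr (e c) end.
exists (@name_elements _ ('I_m + 'I_n)%type h psi) => x y.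
rewrite sat_name_elements -(H (val_sum x y)).
suff -> : sum_val (val_sum x y) id \o h = sum_val (val_sum x y) e by [].
by apply: funext => -[].
Qed.

Lemma absolutely_definableE m n (Q : ('I_m -> B) -> ('I_n -> B) -> Prop) :
  absolutely_definable Q <->
  defset true (fun v : 'I_m + 'I_n -> B =>
    Q (fun i => v (inl i)) (fun j => v (inr j))).
Proof.
split=> [[phi H]|[P [e [psi [HP H]]]]].
  exists void, (fun c : void => match c with end), (rename inl phi).
  split=> [_ []|v].
  by rewrite sat_rename -H val_sumK.
pose h (x : 'I_m + 'I_n + P) : 'I_m + 'I_n :=
  match x with inl y => y | inr c => False_rect _ (HP isT c) end.
exists (@rename _ _ ('I_m + 'I_n)%type h psi) => x y.
rewrite sat_rename -(H (val_sum x y)).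
suff -> : val_sum x y \o h = sum_val (val_sum x y) e by [].
by apply: funext => -[//|c]; case: (HP isT c).
Qed.

End Naming.

Lemma defset_weaken abs L (M : structure L) V (Q : (V -> M) -> Prop) :
  defset abs Q -> defset false Q.
Proof. by move=> [P [e [psi [_ H]]]]; exists P, e, psi. Qed.

(** * Homotopies to the identity *)

(** A homotopy commutes with the coordinate maps, which are injective on
    classes; its graph is thus determined by them, and strong homotopy is
    definability of one specific relation. *)
Lemma graph_preimageE L K (A : structure L) (B : structure K)
    (I1 I2 : triple A B)
    (w1 : well_defined (tpar I1)) (w2 : well_defined (tpar I2))
    (h : coded_structure w1 -> coded_structure w2) x y :
  homotopy h ->
  graph_preimage h x y <->
  [/\ in_dom (tpar I1) x, in_dom (tpar I2) y & tmap I1 x = tmap I2 y].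
Proof.
move=> [_ [m1 [m2 [[_ E1] [[bij2 _ _ _] E2] m12]]]].
have E (b1 : dom (tpar I1)) (b2 : dom (tpar I2)) :
    h (class b1) = class b2 <-> tmap I1 (sval b1) = tmap I2 (sval b2).
  rewrite -E1 -E2 m12; split=> [-> //|]; exact: (bij_inj bij2).
split=> [[hx [hy /E e]] //|[hx hy e]].
by exists hx, hy; apply/E.
Qed.

(** The homotopy is one coordinate isomorphism followed by the inverse of the
    other, so that only definability makes strong homotopy a restriction. *)
Lemma homotopy_exists L K (A : structure L) (B : structure K)
    (I1 I2 : triple A B) :
  interpretation I1 -> interpretation I2 ->
  exists (w1 : well_defined (tpar I1)) (w2 : well_defined (tpar I2))
    (h : coded_structure w1 -> coded_structure w2), homotopy h.
Proof.
move=> [_ [w1 [m1 [i1 E1]]]] [_ [w2 [m2 [i2 E2]]]].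
have [[g gK Kg] c2 f2 R2] := i2.
have [b1 c1 f1 R1] := i1.
exists w1, w2, (g \o m1); split; last first.
  by exists m1, m2; split=> // x; rewrite /= Kg.
split=> [|c|f xs|R xs].
- by apply: bij_comp b1; exists m2.
- by rewrite /= c1 -[cst_in A c]c2 gK.
- apply: (can_inj gK); rewrite /= Kg f1 f2; congr fun_in.
  by apply: funext => i; rewrite /= Kg.
- rewrite R1 R2.
  suff -> : (fun i => m1 (xs i)) = (fun i => m2 ((g \o m1) (xs i))) by [].
  by apply: funext => i; rewrite /= Kg.
Qed.

Lemma id_faithful L (A : structure L) : faithful (id_interpretation A).
Proof.
have e (b b' : 'I_1 -> A) : pair_tup b b' ord_max = b'.
  by rewrite /pair_tup /cons_tup; case: unliftP.
split=> [a|b b' _ _|c b _|f b0 bs _ _|R bs _] //=.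
- by exists (fun=> a).
- by rewrite e /pair_tup /cons_tup unlift_none.
- rewrite /cons_tup unlift_none.
  suff -> : (fun i =>
      (if unlift ord0 (lift ord0 i) is Some j then bs j else b0) ord0) =
    (fun i => bs i ord0) by split=> ->.
  by apply: funext => i; rewrite liftK.
Qed.

(** The graph of the coordinate map, as a set of valuations; by
    [graph_preimageE] it is the relation whose definability makes I strongly
    homotopic to the identical interpretation. *)
Definition id_graph L (A : structure L) (I : triple A A)
    (v : 'I_(dim (tcode I)) + 'I_1 -> A) : Prop :=
  in_dom (tpar I) (fun i => v (inl i)) /\
  tmap I (fun i => v (inl i)) = v (inr ord0).

Arguments id_graph {L A} I v.

Lemma graph_idE L (A : structure L) (I : triple A A)
    (w1 : well_defined (tpar I)) (w2 : well_defined (tpar (id_interpretation A)))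
    (h : coded_structure w1 -> coded_structure w2) v :
  homotopy h ->
  graph_preimage h (fun i => v (inl i)) (fun j => v (inr j)) <-> id_graph I v.
Proof.
move=> hh; rewrite graph_preimageE //.
by split=> [[]|[]].
Qed.

Lemma strongly_homotopic_idE L (A : structure L) (I : triple A A) :
  faithful I ->
  strongly_homotopic I (id_interpretation A) <-> defset false (id_graph I).
Proof.
move=> HI; have iI := faithful_interpretation HI.
have iid := faithful_interpretation (id_faithful A); split.
  case=> _ _ [w1 [w2 [h [hh /definableE]]]].
  by apply: defset_ext => v; exact: (graph_idE v hh).
move=> H; split=> //.
have [w1 [w2 [h hh]]] := homotopy_exists iI iid; exists w1, w2, h; split=> //.
apply/definableE; apply: defset_ext H => v.
exact: iff_sym (graph_idE v hh).
Qed.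

Lemma absolutely_strongly_homotopic_idE L (A : structure L) (I : triple A A) :
  faithful I -> pardim (tcode I) = 0 ->
  absolutely_strongly_homotopic I (id_interpretation A) <->
  defset true (id_graph I).
Proof.
move=> HI I0; have iI := faithful_interpretation HI.
have iid := faithful_interpretation (id_faithful A); split.
  case=> _ _ _ _ [w1 [w2 [h [hh /absolutely_definableE]]]].
  by apply: defset_ext => v; exact: (graph_idE v hh).
move=> H; split=> //.
have [w1 [w2 [h hh]]] := homotopy_exists iI iid; exists w1, w2, h; split=> //.
apply/absolutely_definableE; apply: defset_ext H => v.
exact: iff_sym (graph_idE v hh).
Qed.

(** Strong bi-interpretations for abs = false and absolute ones for abs = true,
    in terms of coordinate maps. *)
Record biinterp (abs : bool) LA LB (A : structure LA) (B : structure LB)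
    (I : triple A B) (J : triple B A) : Prop := Biinterp {
  biinterp_l : faithful I;
  biinterp_r : faithful J;
  biinterp_abs_l : abs -> pardim (tcode I) = 0;
  biinterp_abs_r : abs -> pardim (tcode J) = 0;
  biinterp_def_l : forall pp, par_preimage I J pp ->
    defset abs (id_graph (composition I J pp));
  biinterp_def_r : forall qq, par_preimage J I qq ->
    defset abs (id_graph (composition J I qq)) }.

Lemma strong_bi_interpretationE LA LB (A : structure LA) (B : structure LB)
    (I : triple A B) (J : triple B A) :
  strong_bi_interpretation I J <-> biinterp false I J.
Proof.
split.
  move=> [/interpretation_faithful HI /interpretation_faithful HJ H1 H2].
  split=> // pp Hp.
    by apply/(strongly_homotopic_idE (composition_faithful HI HJ Hp)); exact: H1.
  by apply/(strongly_homotopic_idE (composition_faithful HJ HI Hp)); exact: H2.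
move=> [HI HJ _ _ H1 H2]; split; try exact: faithful_interpretation.
  move=> pp Hp.
  by apply/(strongly_homotopic_idE (composition_faithful HI HJ Hp)); exact: H1.
move=> pp Hp.
by apply/(strongly_homotopic_idE (composition_faithful HJ HI Hp)); exact: H2.
Qed.

Lemma absolute_bi_interpretationE LA LB (A : structure LA) (B : structure LB)
    (I : triple A B) (J : triple B A) :
  absolute_bi_interpretation I J <-> biinterp true I J.
Proof.
have c0 L1 L2 L3 (M1 : structure L1) (M2 : structure L2) (M3 : structure L3)
    (X : triple M1 M2) (Y : triple M2 M3) pp : pardim (tcode X) = 0 ->
    pardim (tcode Y) = 0 -> pardim (tcode (composition X Y pp)) = 0.
  by rewrite /= => -> ->.
split=> [[/strong_bi_interpretationE[HI HJ _ _ _ _] I0 J0 H1 H2]|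
         [HI HJ /(_ isT) I0 /(_ isT) J0 H1 H2]].
- split=> // pp Hp.
    by apply/(absolutely_strongly_homotopic_idE (composition_faithful HI HJ Hp));
      [exact: c0 | exact: H1].
  by apply/(absolutely_strongly_homotopic_idE (composition_faithful HJ HI Hp));
    [exact: c0 | exact: H2].
- split=> //.
  + apply/strong_bi_interpretationE; split=> // pp Hp.
      by apply: defset_weaken (H1 _ Hp).
    by apply: defset_weaken (H2 _ Hp).
  + move=> pp Hp.
    by apply/(absolutely_strongly_homotopic_idE (composition_faithful HI HJ Hp));
      [exact: c0 | exact: H1].
  + move=> pp Hp.
    by apply/(absolutely_strongly_homotopic_idE (composition_faithful HJ HI Hp));
      [exact: c0 | exact: H2].
Qed.

(** * Equality with the identical interpretation *)

Lemma ord_eq1 n (e : n = 1) (i j : 'I_n) : i = j.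
Proof. by move: i j; rewrite e => i j; rewrite !ord1. Qed.

Definition equals_id L (A : structure L) (I : triple A A) : Prop :=
  [/\ dim (tcode I) = 1, forall x, in_dom (tpar I) x &
      forall x j, tmap I x = x j].

(** The symbols need no separate condition: for an interpretation, the formulas
    coding them are determined by the domain and the coordinate map. *)
Lemma interpretation_eq_idE L (A : structure L) (I : triple A A) :
  faithful I -> interpretation_eq I (id_interpretation A) <-> equals_id I.
Proof.
move=> HI; split=> [[e [HD _ _ Hm]]|[e HD Hm]].
  have D x : in_dom (tpar I) x by apply/HD.
  by split=> // x j; rewrite Hm //=; congr x; exact: ord_eq1.
have Hid := id_faithful A.
have m (x : 'I_(dim (tcode I)) -> A) :
    tmap I x = tmap (id_interpretation A) (fun i => x (cast_ord (esym e) i)).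
  exact: Hm.
exists (esym e); split=> //.
- move=> x y Dx Dy; rewrite (faithful_eq HI) // !m.
  by apply: iff_sym; apply: (faithful_eq Hid).
- split.
  + move=> c x Dx; rewrite (faithful_cst HI) // m.
    by apply: iff_sym; apply: (faithful_cst Hid).
  + move=> f xs Dxs; rewrite -(cons_tupK xs) (faithful_fun HI) // m.
    rewrite (cons_tup_map (fun x i => x (cast_ord (esym e) i))).
    have -> : (fun i => tmap I (xs (lift ord0 i))) =
        (fun i => tmap (id_interpretation A)
          (fun j => xs (lift ord0 i) (cast_ord (esym e) j))).
      by apply: funext => i; exact: m.
    by apply: iff_sym; apply: (faithful_fun Hid).
  + move=> R xs Dxs; rewrite (faithful_pred HI) //.
    have -> : (fun i => tmap I (xs i)) =
        (fun i => tmap (id_interpretation A)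
          (fun j => xs i (cast_ord (esym e) j))).
      by apply: funext => i; exact: m.
    by apply: iff_sym; apply: (faithful_pred Hid).
Qed.

Lemma composition_total LA LB LC (A : structure LA) (B : structure LB)
    (C : structure LC) (I : triple A B) (J : triple B C) pp :
  faithful J -> par_preimage I J pp -> 'I_(dim (tcode I)) ->
  (forall x, in_dom (tpar (composition I J pp)) x) ->
  (forall b, in_dom (tpar I) b) /\ (forall z, in_dom (tpar J) z).
Proof.
move=> HJ Hpp i H; split=> [b|z].
  have [x _ <-] := block_map_onto HJ b.
  by have /(in_dom_composition _ HJ Hpp)[] := H x.
have /(in_dom_composition _ HJ Hpp)[/(_ i)] := H (unblock (fun=> z)).
by rewrite block_unblock.
Qed.

(** * The round trip A, B, C, B, A *)

Section RoundTrip.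

Variables (abs : bool) (LA LB LC : language).
Variables (A : structure LA) (B : structure LB) (C : structure LC).
Variables (I : triple A B) (J : triple B A) (I2 : triple B C) (J2 : triple C B).
Hypotheses (HJ : faithful J) (HI2 : faithful I2) (HJ2 : faithful J2).
Variables (pp1 : 'I_(pardim (tcode I) * dim (tcode J)) -> A).
Variables (pp2 : 'I_(pardim (tcode I2) * dim (tcode J2)) -> B).
Hypotheses (Hpp1 : par_preimage I J pp1) (Hpp2 : par_preimage I2 J2 pp2).
Variables (pp : 'I_(pardim (tcode I) * dim (tcode I2)) -> C).
Variables (qq : 'I_(pardim (tcode J2) * dim (tcode J)) -> A).
Hypotheses (Hpp : par_preimage I I2 pp) (Hqq : par_preimage J2 J qq).
Variables (E : formula LC (code_vars (dim (tcode I) * dim (tcode I2))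
             (pardim (tcode I) * dim (tcode I2) + pardim (tcode I2)) 2)).
Variables (E' : formula LA (code_vars (dim (tcode J2) * dim (tcode J))
             (pardim (tcode J2) * dim (tcode J) + pardim (tcode J)) 2)).

Local Notation X := (composition_with I I2 pp E).
Local Notation Y := (composition_with J2 J qq E').

Hypothesis HY : faithful Y.
Variable (rr : 'I_(pardim (tcode X) * dim (tcode Y)) -> A).
Hypothesis Hrr : par_preimage X Y rr.

Local Notation n := (dim (tcode X) * dim (tcode Y)).

(* middle x i is the (dim I2 * dim J2)-tuple of elements of B ... *)
(** What an element of A^n looks like halfway: a point of I o I2 o J2 o J has
    one coordinate for each index of I, I2, J2 and J; applying the coordinate
    map of J leaves, for each index i of I, a tuple of B to which I2 o J2 applies.
    The indices are regrouped, from (i, i2), (k2, j) to i, (i2, k2), j. *)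
Definition middle (x : 'I_n -> A) (i : 'I_(dim (tcode I))) :
    'I_(dim (tcode I2) * dim (tcode J2)) -> B :=
  unblock (fun i2 k2 =>
    tmap J (fun j => x (mxvec_index (mxvec_index i i2) (mxvec_index k2 j)))).

Lemma block_map_middle x i :
  block_map (I := I2) (J := J2) (middle x i) =
  block (block_map (I := X) (J := Y) x) i.
Proof. by apply: funext => i2; rewrite /block_map block_unblock. Qed.

Lemma middle_dom x : in_dom (tpar (composition X Y rr)) x ->
  forall i, in_dom (tpar (composition I2 J2 pp2)) (middle x i).
Proof.
move=> /(in_dom_composition _ HY Hrr).
case=> HYx /(in_dom_composition_with HI2 Hpp _ _)[HI2x _] i.
apply/(in_dom_composition _ HJ2 Hpp2).
split; last by rewrite block_map_middle; exact: HI2x.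
move=> i2; rewrite block_unblock.
by have /(in_dom_composition_with HJ Hqq _ _)[_] := HYx (mxvec_index i i2).
Qed.

Lemma middle_tmap x i :
  tmap (composition I2 J2 pp2) (middle x i) =
  block_map (I := I) (J := I2) (block_map (I := X) (J := Y) x) i.
Proof.
rewrite /= -[LHS]/(tmap I2 (block_map (I := I2) (J := J2) (middle x i))).
by rewrite block_map_middle.
Qed.

Lemma middle_args_dom x : in_dom (tpar (composition X Y rr)) x ->
  forall i i2 k2, in_dom (tpar J)
    (fun j => x (mxvec_index (mxvec_index i i2) (mxvec_index k2 j))).
Proof.
move=> /(in_dom_composition _ HY Hrr).
case=> HYx _ i i2 k2.
have /(in_dom_composition_with HJ Hqq _ _)[H _] := HYx (mxvec_index i i2).
exact: H.
Qed.

(** For w one takes, at each coordinate i of I, a J-code of the value in B of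
    [middle x i]; any other choice has the same image under J, so that the value
    of w under I o J is that of x under the round trip. *)
Lemma round_trip_graph v :
  id_graph (composition X Y rr) v <->
  in_dom (tpar (composition X Y rr)) (fun i => v (inl i)) /\
  exists w : 'I_(dim (tcode I) * dim (tcode J)) -> A,
    (forall i, in_dom (tpar J) (block w i) /\
      tmap (composition I2 J2 pp2) (middle (fun i => v (inl i)) i) =
      tmap J (block w i)) /\
    id_graph (composition I J pp1) (val_sum w (fun _ : 'I_1 => v (inr ord0))).
Proof.
set x := fun i => v (inl i).
split=> -[Hx].
  move=> Hv; split=> //.
  have [w Hw e] := block_map_onto HJ (block_map (I := I) (J := I2)
    (block_map (I := X) (J := Y) x)).
  exists w; split; first by move=> i; split=> //; rewrite middle_tmap -e.
  split; last by rewrite /= -Hv /=; congr (tmap I); exact: e.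
  apply/(in_dom_composition _ HJ Hpp1).
  split=> //; rewrite e.
  have := Hx.
  move=> /(in_dom_composition _ HY Hrr).
  by case=> _ /(in_dom_composition_with HI2 Hpp _ _)[].
move=> [w [Hw [_ Hv]]]; split=> //; rewrite -[RHS]Hv /=; congr (tmap I).
by apply: funext => i; have [_ <-] := Hw i; rewrite middle_tmap.
Qed.

(** The description of the graph in [round_trip_graph] uses only conjunctions,
    an existential quantifier over tuples and a pullback along J. *)
Lemma defset_round_trip :
  (abs -> pardim (tcode J) = 0) -> (abs -> pardim (tcode X) = 0) ->
  (abs -> pardim (tcode Y) = 0) ->
  defset abs (id_graph (composition I J pp1)) ->
  defset abs (id_graph (composition I2 J2 pp2)) ->
  defset abs (id_graph (composition X Y rr)).
Proof.
move=> J0 X0 Y0 D1 D2.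
have DX : defset abs (in_dom (tpar (composition X Y rr))).
  by apply: defset_in_dom => a; move: (X0 a) (Y0 a); rewrite /= => -> ->.
pose V := ('I_n + 'I_1 + 'I_(dim (tcode I) * dim (tcode J)))%type.
(* The variables of the graph of I2 o J2, at coordinate i: those of middle x i
   are read in x, the value is read in the i-th block of w. *)
pose h (i : 'I_(dim (tcode I)))
    (z : ('I_(dim (tcode I2) * dim (tcode J2)) + 'I_1) * 'I_(dim (tcode J))) :
    V :=
  match z with
  | (inl k, j) => inl (inl (unblock (fun i2 k2 =>
       mxvec_index (mxvec_index i i2) (mxvec_index k2 j)) k))
  | (inr _, j) => inr (mxvec_index i j)
  end.
have D3 i := defset_rename (h i) (defset_pullback HJ J0 D2).
pose h1 (z : 'I_(dim (tcode I) * dim (tcode J)) + 'I_1) : V :=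
  match z with inl k => inr k | inr _ => inl (inr ord0) end.
have D4 := defset_and (defset_forall D3) (defset_rename h1 D1).
apply: defset_ext (defset_and (defset_rename inl DX) (defset_exists D4)) => v.
rewrite round_trip_graph; set x := fun i => v (inl i).
have middleE w i :
    (fun k => tmap J (fun j => (val_sum v w \o h i) (inl k, j))) = middle x i.
  apply: funext; move=> k; case/mxvec_indexP: k => i2 k2.
  rewrite /middle unblockE; congr (tmap J); apply: funext => j /=.
  by rewrite unblockE.
have h1E w : val_sum v w \o h1 = val_sum w (fun _ : 'I_1 => v (inr ord0)).
  by apply: funext => -[].
split=> -[Hx [w [Hw Hv]]]; split=> //; exists w; move: Hv; rewrite h1E;
  split=> //.
  move=> i; have [Hd [Hi]] := Hw i; rewrite middleE => e.
  by split=> //; exact: (Hd (inr ord0)).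
move=> i; have [Hd e] := Hw i; split.
  move=> z; case: z => [k|u]; last exact: Hd.
  case/mxvec_indexP: k => i2 k2.
  have := middle_args_dom Hx i i2 k2.
  suff -> : (fun j => x (mxvec_index (mxvec_index i i2) (mxvec_index k2 j))) =
    (fun j => (val_sum v w \o h i) (inl (mxvec_index i2 k2), j)) by [].
  by apply: funext => j /=; rewrite unblockE.
by rewrite /id_graph middleE; split=> //; exact: middle_dom.
Qed.

(** All dimensions being 1, the coordinate map of I2 o J2 returns the only entry
    of [middle x i], which is the value under J of a tuple of entries of x; the
    coordinate map of I o J then returns the only entry of x. *)
Lemma round_trip_equals_id :
  equals_id (composition I J pp1) -> equals_id (composition I2 J2 pp2) ->
  equals_id (composition X Y rr).
Proof.
move=> [d1 T1 M1] [d2 T2 M2].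
have [dI dJ] : dim (tcode I) = 1 /\ dim (tcode J) = 1.
  by move/eqP: d1; rewrite muln_eq1 => /andP[/eqP -> /eqP ->].
have [dI2 dJ2] : dim (tcode I2) = 1 /\ dim (tcode J2) = 1.
  by move/eqP: d2; rewrite muln_eq1 => /andP[/eqP -> /eqP ->].
have dXY : dim (tcode (composition X Y rr)) = 1 by rewrite /= dI dI2 dJ2 dJ.
have i1 : 'I_(dim (tcode I)) by rewrite dI; exact: ord0.
have i2 : 'I_(dim (tcode I2)) by rewrite dI2; exact: ord0.
have k2 : 'I_(dim (tcode J2)) by rewrite dJ2; exact: ord0.
have j1 : 'I_(dim (tcode J)) by rewrite dJ; exact: ord0.
have [totI totJ] := composition_total HJ Hpp1 i1 T1.
have [totI2 totJ2] := composition_total HJ2 Hpp2 i2 T2.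
split=> // [x|x j].
  apply/(in_dom_composition _ HY Hrr); split=> [k|].
    by apply/(in_dom_composition_with HJ Hqq).
  by apply/(in_dom_composition_with HI2 Hpp).
pose w := unblock (fun i j =>
  x (mxvec_index (mxvec_index i i2) (mxvec_index k2 j))).
rewrite (ord_eq1 dXY j (mxvec_index (mxvec_index i1 i2) (mxvec_index k2 j1))).
have <- : w (mxvec_index i1 j1) =
    x (mxvec_index (mxvec_index i1 i2) (mxvec_index k2 j1)).
  exact: unblockE.
rewrite -M1 /=; congr (tmap I); apply: funext => i.
have := middle_tmap x i; rewrite /block_map => <-.
by rewrite (M2 _ (mxvec_index i2 k2)) /middle unblockE /w block_unblock.
Qed.

End RoundTrip.

(** * Transitivity *)

Lemma biinterp_composition_with (abs : bool) LA LB LC (A : structure LA)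
    (B : structure LB) (C : structure LC) (I : triple A B) (J : triple B A)
    (I2 : triple B C) (J2 : triple C B) pp qq E E' :
  biinterp abs I J -> biinterp abs I2 J2 ->
  par_preimage I I2 pp -> par_preimage J2 J qq ->
  faithful (composition_with I I2 pp E) ->
  faithful (composition_with J2 J qq E') ->
  biinterp abs (composition_with I I2 pp E) (composition_with J2 J qq E').
Proof.
move=> [HI HJ I0 J0 D1 D1'] [HI2 HJ2 I20 J20 D2 D2'] Hpp Hqq HX HY.
have X0 : abs -> pardim (tcode (composition_with I I2 pp E)) = 0.
  by move=> a; rewrite /= I0 // I20.
have Y0 : abs -> pardim (tcode (composition_with J2 J qq E')) = 0.
  by move=> a; rewrite /= J0 // J20.
have [p1 Hp1] := par_preimage_exists I HJ.
have [p2 Hp2] := par_preimage_exists I2 HJ2.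
have [q1 Hq1] := par_preimage_exists J HI.
have [q2 Hq2] := par_preimage_exists J2 HI2.
split=> // rr Hrr.
  exact: (defset_round_trip HJ HI2 HJ2 Hp1 Hp2 Hpp Hqq HY Hrr J0 X0 Y0
    (D1 _ Hp1) (D2 _ Hp2)).
(* The same lemma, with the roles of A and C exchanged. *)
exact: (defset_round_trip HI2 HJ HI Hq2 Hq1 Hqq Hpp HX Hrr I20 Y0 X0
    (D2' _ Hq2) (D1' _ Hq1)).
Qed.

Lemma biinterp_trans (abs : bool) LA LB LC (A : structure LA)
    (B : structure LB) (C : structure LC) (I : triple A B) (J : triple B A)
    (I2 : triple B C) (J2 : triple C B) :
  biinterp abs I J -> biinterp abs I2 J2 ->
  exists (X : triple A C) (Y : triple C A), biinterp abs X Y.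
Proof.
move=> b1 b2.
have [pp Hpp] := par_preimage_exists I (biinterp_l b2).
have [qq Hqq] := par_preimage_exists J2 (biinterp_r b1).
have HX := composition_faithful (biinterp_l b1) (biinterp_l b2) Hpp.
have HY := composition_faithful (biinterp_r b2) (biinterp_r b1) Hqq.
exists (composition I I2 pp), (composition J2 J qq).
exact: (biinterp_composition_with b1 b2 Hpp Hqq HX HY).
Qed.

Lemma biinterp_injective_trans (abs : bool) LA LB LC (A : structure LA)
    (B : structure LB) (C : structure LC) (I : triple A B) (J : triple B A)
    (I2 : triple B C) (J2 : triple C B) :
  biinterp abs I J -> injective_triples I J ->
  biinterp abs I2 J2 -> injective_triples I2 J2 ->
  exists (X : triple A C) (Y : triple C A),
    biinterp abs X Y /\ injective_triples X Y.
Proof.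
move=> b1 [i1 j1] b2 [i2 j2].
have [pp Hpp] := par_preimage_exists I (biinterp_l b2).
have [qq Hqq] := par_preimage_exists J2 (biinterp_r b1).
have HX := composition_with_tuple_eq_faithful (biinterp_l b1) (biinterp_l b2)
  Hpp i1 i2.
have HY := composition_with_tuple_eq_faithful (biinterp_r b2) (biinterp_r b1)
  Hqq j2 j1.
exists (composition_with I I2 pp (tuple_eq LC _ _)).
exists (composition_with J2 J qq (tuple_eq LA _ _)).
by split=> //; exact: (biinterp_composition_with b1 b2 Hpp Hqq HX HY).
Qed.

Lemma syntactically_isomorphic_trans LA LB LC (A : structure LA)
    (B : structure LB) (C : structure LC) :
  syntactically_isomorphic A B -> syntactically_isomorphic B C ->
  syntactically_isomorphic A C.
Proof.
move=> [I [J [/strong_bi_interpretationE b1 e1 e1']]].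
move=> [I2 [J2 [/strong_bi_interpretationE b2 e2 e2']]].
have [HI HJ _ _ _ _] := b1; have [HI2 HJ2 _ _ _ _] := b2.
have [pp Hpp] := par_preimage_exists I HI2.
have [qq Hqq] := par_preimage_exists J2 HJ.
have HX := composition_faithful HI HI2 Hpp.
have HY := composition_faithful HJ2 HJ Hqq.
have [p1 Hp1] := par_preimage_exists I HJ.
have [p2 Hp2] := par_preimage_exists I2 HJ2.
have [q1 Hq1] := par_preimage_exists J HI.
have [q2 Hq2] := par_preimage_exists J2 HI2.
have /(interpretation_eq_idE (composition_faithful HI HJ Hp1)) C1 := e1 _ Hp1.
have /(interpretation_eq_idE (composition_faithful HI2 HJ2 Hp2)) C2 := e2 _ Hp2.
have /(interpretation_eq_idE (composition_faithful HJ HI Hq1)) C1' := e1' _ Hq1.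
have /(interpretation_eq_idE (composition_faithful HJ2 HI2 Hq2)) C2' :=
  e2' _ Hq2.
exists (composition I I2 pp), (composition J2 J qq); split.
- apply/strong_bi_interpretationE.
  exact: (biinterp_composition_with b1 b2 Hpp Hqq HX HY).
- move=> rr Hrr; apply/(interpretation_eq_idE (composition_faithful HX HY Hrr)).
  exact: (round_trip_equals_id HJ HI2 HJ2 Hp1 Hp2 Hpp Hqq HY Hrr C1 C2).
- move=> rr Hrr; apply/(interpretation_eq_idE (composition_faithful HY HX Hrr)).
  exact: (round_trip_equals_id HI2 HJ HI Hq2 Hq1 Hqq Hpp HX Hrr C2' C1').
Qed.

Theorem proposition12 (LA LB LC : language)
    (A : structure LA) (B : structure LB) (C : structure LC) :
  (strongly_bi_interpretable A B -> strongly_bi_interpretable B C ->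
   strongly_bi_interpretable A C) /\
  (strongly_injectively_bi_interpretable A B ->
   strongly_injectively_bi_interpretable B C ->
   strongly_injectively_bi_interpretable A C) /\
  (strongly_absolutely_bi_interpretable A B ->
   strongly_absolutely_bi_interpretable B C ->
   strongly_absolutely_bi_interpretable A C) /\
  (strongly_absolutely_injectively_bi_interpretable A B ->
   strongly_absolutely_injectively_bi_interpretable B C ->
   strongly_absolutely_injectively_bi_interpretable A C) /\
  (syntactically_isomorphic A B -> syntactically_isomorphic B C ->
   syntactically_isomorphic A C).
Proof.
split; first move=> [I [J /strong_bi_interpretationE b1]]
    [I2 [J2 /strong_bi_interpretationE b2]].
  have [X [Y b]] := biinterp_trans b1 b2.
  by exists X, Y; apply/strong_bi_interpretationE.
split; first move=> [I [J [/strong_bi_interpretationE b1 i1]]]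
    [I2 [J2 [/strong_bi_interpretationE b2 i2]]].
  have [X [Y [b i]]] := biinterp_injective_trans b1 i1 b2 i2.
  by exists X, Y; split=> //; apply/strong_bi_interpretationE.
split; first move=> [I [J /absolute_bi_interpretationE b1]]
    [I2 [J2 /absolute_bi_interpretationE b2]].
  have [X [Y b]] := biinterp_trans b1 b2.
  by exists X, Y; apply/absolute_bi_interpretationE.
split; first move=> [I [J [/absolute_bi_interpretationE b1 i1]]]
    [I2 [J2 [/absolute_bi_interpretationE b2 i2]]].
  have [X [Y [b i]]] := biinterp_injective_trans b1 i1 b2 i2.
  by exists X, Y; split=> //; apply/absolute_bi_interpretationE.
exact: syntactically_isomorphic_trans.
Qed.
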